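(* Let $A$ be a closed symmetric linear relation in a Hilbert space $\mathfrak H$ with equal finite deficiency indices $n_+(A)=n_-(A)<\infty$, let $\Pi=\{\mathcal H,\Gamma_0,\Gamma_1\}$ be a boundary triplet for $A^*$, let $\tau\in\widetilde R(\mathcal H)$ and let $\widetilde A=\widetilde A_\tau$ be the corresponding exit space self-adjoint extension of $A$. Let $\tau_0\in R[\mathcal H_0]$ and $\mathcal K$ be the operator and multivalued parts of $\tau$. Then the Shtraus family $S_{\widetilde A}(t)$ of $\widetilde A$ is given in the triplet $\Pi$ by $$S_{\widetilde A}(t)=A_{\eta(t)}=\{\widehat f\in A^*:\{\Gamma_0\widehat f,\Gamma_1\widehat f\}\in\eta(t)\},\qquad t\in\mathbb R,$$ where $$\eta(t)=\eta_\tau(t)=\{\{h,-D_{\tau_0}(t)h+\mathcal B_{\tau_0}(t)h_0+\kappa\}:h\in\operatorname{dom}D_{\tau_0}(t),\ h_0\in\mathcal H_0,\ \kappa\in\mathcal K\}.$$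
   Context: Hilbert spaces are complex and separable; $B(\mathcal H)$ denotes bounded operators. A linear relation in $\mathcal H$ is a linear subspace $T\subset\mathcal H\oplus\mathcal H$ with elements $\{f,f'\}$; operators are identified with their graphs. $\operatorname{mul}T=\{f':\{0,f'\}\in T\}$, $T-\lambda=\{\{f,f'-\lambda f\}:\{f,f'\}\in T\}$, $-T=\{\{f,-f'\}\}$, $T^{-1}=\{\{f',f\}\}$, $T^*=\{\{g,g'\}:(f',g)=(f,g')\ \forall\{f,f'\}\in T\}$; $T$ is symmetric if $T\subset T^*$, self-adjoint if $T=T^*$. $n_\pm(A)=\dim\ker(A^*-\lambda)$, $\lambda\in\mathbb C_\pm$. Boundary triplet for $A^*$: a Hilbert space $\mathcal H$ and linear maps $\Gamma_0,\Gamma_1:A^*\to\mathcal H$ such that $(\Gamma_0,\Gamma_1)^\top:A^*\to\mathcal H\oplus\mathcal H$ is surjective and $(f',g)-(f,g')=(\Gamma_1\widehat f,\Gamma_0\widehat g)-(\Gamma_0\widehat f,\Gamma_1\widehat g)$ for all $\widehat f=\{f,f'\},\widehat g=\{g,g'\}\in A^*$ (then $\dim\mathcal H=n_\pm(A)$). For a relation $\theta$ in $\mathcal H$, $A_\theta=\{\widehat f\in A^*:\{\Gamma_0\widehat f,\Gamma_1\widehat f\}\in\theta\}$. $\widetilde R(\mathcal H)$: functions $\tau$ on $\mathbb C\setminus\mathbb R$ whose values are closed linear relations in $\mathcal H$ such that $\operatorname{Im}(f',f)\ge0$ for $\{f,f'\}\in\tau(\lambda)$, $\lambda\in\mathbb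 C_+$; $(\tau(\lambda)+i)^{-1}\in B(\mathcal H)$ for $\lambda\in\mathbb C_+$ and is holomorphic there; $\tau^*(\lambda)=\tau(\bar\lambda)$. The multivalued part $\mathcal K=\operatorname{mul}\tau(\lambda)$ is independent of $\lambda$, and with $\mathcal H_0=\mathcal H\ominus\mathcal K$ one has $\tau(\lambda)=\{\{h_0,\tau_0(\lambda)h_0+k\}:h_0\in\mathcal H_0,k\in\mathcal K\}$ (here $\dim\mathcal H<\infty$) with the operator part $\tau_0\in R[\mathcal H_0]$, the class of holomorphic $\tau_0:\mathbb C\setminus\mathbb R\to B(\mathcal H_0)$ with $\operatorname{Im}\lambda\cdot\operatorname{Im}\tau_0(\lambda)\ge0$, $\tau_0^*(\lambda)=\tau_0(\bar\lambda)$. For $t\in\mathbb R$: $\mathcal B_{\tau_0}(t)=\lim_{y\to0}(-iy\,\tau_0(t+iy))\in B(\mathcal H_0)$, $\operatorname{dom}D_{\tau_0}(t)=\{h\in\mathcal H_0:\lim_{y\to0}\frac1y\operatorname{Im}(\tau_0(t+iy)h,h)<\infty\}$, $D_{\tau_0}(t)h=\lim_{y\to0}\tau_0(t+iy)h$ for $h\in\operatorname{dom}D_{\tau_0}(t)$ (these limits are known to exist). Exit space extension of $A$: a relation $\widetilde A=\widetilde A^*$ in a Hilbert space $\widetilde{\mathfrak H}\supset\mathfrak H$ with $A\subset\widetilde A$ and no nontrivial subspace of $\widetilde{\mathfrak H}\ominus\mathfrak H$ reducing $\widetilde A$; extensions unitarily equivalent via a unitary that is the identity on $\mathfrak H$ are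 identified. For each $\tau\in\widetilde R(\mathcal H)$, $\widetilde A_\tau$ is the unique exit space extension with $P_{\mathfrak H}(\widetilde A_\tau-\lambda)^{-1}|_{\mathfrak H}=(A_{-\tau(\lambda)}-\lambda)^{-1}$, $\lambda\in\mathbb C\setminus\mathbb R$. Shtraus family of $\widetilde A$: with $\mathfrak H_r=\widetilde{\mathfrak H}\ominus\mathfrak H$, $S_{\widetilde A}(\lambda)=\{\{f,f'\}\in\mathfrak H^2:\{f\oplus f_r,f'\oplus\lambda f_r\}\in\widetilde A\text{ for some }f_r\in\mathfrak H_r\}$, $\lambda\in\mathbb C$. *)

(* Defs.v *)
From HB Require Import structures.
From mathcomp Require Import all_boot all_order all_algebra.
From mathcomp Require Import complex.
From mathcomp Require Import all_classical all_reals all_analysis.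

Set Implicit Arguments.
Unset Strict Implicit.
Unset Printing Implicit Defensive.

Import Order.TTheory GRing.Theory Num.Theory.
Import numFieldNormedType.Exports.

Local Open Scope classical_set_scope.
Local Open Scope ring_scope.
Local Open Scope complex_scope.

(* Complex separable Hilbert spaces.  The inner product [hdot f g] is linear
   in [f] and conjugate-linear in [g]. *)
HB.mixin Record CompleteNormedModule_isHilbert (R : realType) V
    & CompleteNormedModule R[i] V := {
  hdot : {dot V for @Num.conj R[i]} ;
  hdot_norm : forall x : V, `|x| ^+ 2 = hdot x x ;
  hilbert_separable : exists2 S : set V, countable S & dense S
}.

#[short(type="hilbertType")]
HB.structure Definition Hilbert (R : realType) :=
  {V of CompleteNormedModule_isHilbert R V & CompleteNormedModule R[i] V}.

Section Subspaces.
Variable R : realType.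

Definition is_subspace (W : lmodType R[i]) (M : set W) : Prop :=
  M 0 /\ forall (a : R[i]) u v, M u -> M v -> M (a *: u + v).

Definition linear_on (W W' : lmodType R[i]) (M : set W) (F : W -> W') : Prop :=
  forall (a : R[i]) u v, M u -> M v -> F (a *: u + v) = a *: F u + F v.

Definition has_dim (W : lmodType R[i]) (M : set W) (n : nat) : Prop :=
  exists e : 'I_n -> W,
    (forall a : 'I_n -> R[i], \sum_i a i *: e i = 0 -> forall i, a i = 0) /\
    M = [set x | exists a : 'I_n -> R[i], x = \sum_i a i *: e i].

Definition orth (V : hilbertType R) (M : set V) : set V :=
  [set x | forall y, M y -> hdot x y = 0].

End Subspaces.

Section LinearRelations.
Variables (R : realType) (V : hilbertType R).
Implicit Types (T : set (V * V)) (l : R[i]).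

Definition rel_mul T : set V := [set f' | T (0, f')].

Definition rel_ker T : set V := [set f | T (f, 0)].

Definition rel_sub T l : set (V * V) :=
  [set q | exists2 p, T p & q = (p.1, p.2 - l *: p.1)].

Definition rel_opp T : set (V * V) :=
  [set q | exists2 p, T p & q = (p.1, - p.2)].

Definition rel_inv T : set (V * V) :=
  [set q | exists2 p, T p & q = (p.2, p.1)].

Definition rel_adj T : set (V * V) :=
  [set q | forall p, T p -> hdot p.2 q.1 = hdot p.1 q.2].

Definition rel_symmetric T : Prop := T `<=` rel_adj T.

Definition rel_selfadjoint T : Prop := T = rel_adj T.

Definition graph (F : V -> V) : set (V * V) := [set q | q.2 = F q.1].

(* The closed subspace [M] reduces [T]: T is the orthogonal sum of its parts
   in M and in the orthogonal complement of M. *)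
Definition rel_reduces (M : set V) T : Prop :=
  [/\ is_subspace M, closed M
    & forall p, T p -> exists q r,
        [/\ p = q + r, T q /\ T r, M q.1 /\ M q.2 & orth M r.1 /\ orth M r.2]].

Definition deficiency_plus T (n : nat) : Prop :=
  forall l, 0 < complex.Im l -> has_dim (rel_ker (rel_sub (rel_adj T) l)) n.

Definition deficiency_minus T (n : nat) : Prop :=
  forall l, complex.Im l < 0 -> has_dim (rel_ker (rel_sub (rel_adj T) l)) n.

End LinearRelations.

(* A bounded operator in a closed subspace [M] of [V] is represented by a
   total function on [V] whose values outside [M] are irrelevant. *)
Section OperatorFunctions.
Variables (R : realType) (V : hilbertType R).
Implicit Types (M : set V) (F : R[i] -> V -> V) (l : R[i]).

Definition bounded_op_on M (B : V -> V) : Prop :=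
  [/\ forall h, M h -> M (B h), linear_on M B
    & exists C : R, forall h, M h -> `|B h| <= C%:C * `|h|].

(* Complex differentiability at [l] with respect to the operator norm. *)
Definition holomorphic_op_at M F l : Prop :=
  exists2 B : V -> V, bounded_op_on M B &
    forall e : R, 0 < e -> \forall m \near (l : R[i]^o)^', forall h, M h ->
      `|(m - l)^-1 *: (F m h - F l h) - B h| <= e%:C * `|h|.

End OperatorFunctions.

Section BoundaryTriplets.
Variables (R : realType) (H G : hilbertType R).

Record boundary_triplet (A : set (H * H)) (G0 G1 : H * H -> G) : Prop := {
  bt_linear0 : linear_on (rel_adj A) G0 ;
  bt_linear1 : linear_on (rel_adj A) G1 ;
  bt_surjective : forall u : G * G, exists2 f, rel_adj A f & (G0 f, G1 f) = u ;
  bt_green : forall f g, rel_adj A f -> rel_adj A g ->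
    hdot f.2 g.1 - hdot f.1 g.2 = hdot (G1 f) (G0 g) - hdot (G0 f) (G1 g)
}.

Definition triplet_ext (A : set (H * H)) (G0 G1 : H * H -> G)
    (theta : set (G * G)) : set (H * H) :=
  [set f | rel_adj A f /\ theta (G0 f, G1 f)].

End BoundaryTriplets.

Section Nevanlinna.
Variables (R : realType) (G : hilbertType R).

(* The class R~(G); only the values of [tau] off the real axis matter. *)
Record nevanlinna_family (tau : R[i] -> set (G * G)) : Prop := {
  nf_closed_rel : forall l, complex.Im l != 0 ->
    is_subspace (tau l) /\ closed (tau l) ;
  nf_dissipative : forall l, 0 < complex.Im l ->
    forall p, tau l p -> 0 <= complex.Im (hdot p.2 p.1) ;
  nf_holomorphic : exists F : R[i] -> G -> G, forall l, 0 < complex.Im l ->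
    [/\ bounded_op_on setT (F l),
        rel_inv (rel_sub (tau l) (- 'i)) = graph (F l)
      & holomorphic_op_at setT F l] ;
  nf_adjoint : forall l, complex.Im l != 0 ->
    rel_adj (tau l) = tau (Num.conj l)
}.

(* The class R[M] for a closed subspace [M]. *)
Record nevanlinna_op (M : set G) (tau0 : R[i] -> G -> G) : Prop := {
  no_bounded : forall l, complex.Im l != 0 -> bounded_op_on M (tau0 l) ;
  no_holomorphic : forall l, complex.Im l != 0 -> holomorphic_op_at M tau0 l ;
  no_im : forall l, complex.Im l != 0 -> forall h, M h ->
    0 <= complex.Im l * complex.Im (hdot (tau0 l h) h) ;
  no_adjoint : forall l, complex.Im l != 0 -> forall h g, M h -> M g ->
    hdot (tau0 l h) g = hdot h (tau0 (Num.conj l) g)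
}.

(* [K] is the multivalued part and [tau0] the operator part, acting in
   [orth K], of the family [tau]. *)
Record nevanlinna_parts (tau : R[i] -> set (G * G)) (K : set G)
    (tau0 : R[i] -> G -> G) : Prop := {
  np_mul : forall l, complex.Im l != 0 -> rel_mul (tau l) = K ;
  np_op : nevanlinna_op (orth K) tau0 ;
  np_decomp : forall l, complex.Im l != 0 ->
    tau l = [set q | exists h0 k,
      [/\ orth K h0, K k & q = (h0, tau0 l h0 + k)]]
}.

Definition nev_B (tau0 : R[i] -> G -> G) (t : R) (h : G) : G :=
  lim ((fun y : R => (- 'i * y%:C) *: tau0 (t +i* y) h) @ 0^').

(* The quotient is nonnegative and has a limit in [0, +oo], so finiteness of
   the limit is convergence in R. *)
Definition nev_domD (M : set G) (tau0 : R[i] -> G -> G) (t : R) : set G :=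
  [set h | M h /\
    cvg ((fun y : R => y^-1 * complex.Im (hdot (tau0 (t +i* y) h) h)) @ 0^')].

Definition nev_D (tau0 : R[i] -> G -> G) (t : R) (h : G) : G :=
  lim ((fun y : R => tau0 (t +i* y) h) @ 0^').

Definition nev_eta (K : set G) (tau0 : R[i] -> G -> G) (t : R) : set (G * G) :=
  [set q | exists h h0 k,
    [/\ nev_domD (orth K) tau0 t h, orth K h0, K k
      & q = (h, - nev_D tau0 t h + nev_B tau0 t h0 + k)]].

End Nevanlinna.

(* The exit space Ht contains H through a linear isometry [iota]. *)
Section ExitSpace.
Variables (R : realType) (H Ht : hilbertType R) (iota : {linear H -> Ht}).

Definition is_isometry : Prop :=
  forall f g : H, hdot (iota f) (iota g) = hdot f g.

Record exit_space_extension (A : set (H * H)) (At : set (Ht * Ht)) : Prop := {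
  ese_isometry : is_isometry ;
  ese_selfadjoint : rel_selfadjoint At ;
  ese_extends : forall f, A f -> At (iota f.1, iota f.2) ;
  ese_minimal : forall M : set Ht, M `<=` orth (range iota) ->
    rel_reduces M At -> M = [set 0]
}.

(* The compression P_H T |_ H: [f] is sent to [g] when some value of T at
   [iota f] has the orthogonal projection [iota g] onto H. *)
Definition compression (T : set (Ht * Ht)) : set (H * H) :=
  [set q | exists2 g, T (iota q.1, g) & orth (range iota) (g - iota q.2)].

Definition shtraus (At : set (Ht * Ht)) (l : R[i]) : set (H * H) :=
  [set f | exists2 fr, orth (range iota) fr &
    At (iota f.1 + fr, iota f.2 + l *: fr)].

(* [At] is the exit space extension of [A] corresponding to [tau]. *)
Definition exit_ext_of (G : hilbertType R) (A : set (H * H))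
    (G0 G1 : H * H -> G) (tau : R[i] -> set (G * G))
    (At : set (Ht * Ht)) : Prop :=
  exit_space_extension A At /\
  forall l, complex.Im l != 0 ->
    compression (rel_inv (rel_sub At l)) =
    rel_inv (rel_sub (triplet_ext A G0 G1 (rel_opp (tau l))) l).

End ExitSpace.

(* Main.v *)
Require Import Defs.
From HB Require Import structures.
From mathcomp Require Import all_boot all_order all_algebra.
From mathcomp Require Import complex.
From mathcomp Require Import all_classical all_reals all_analysis.
From mathcomp Require Import ring lra.

Set Implicit Arguments.
Unset Strict Implicit.
Unset Printing Implicit Defensive.

Import numFieldNormedType.Exports.
Import Order.TTheory GRing.Theory Num.Theory.

Local Open Scope classical_set_scope.
Local Open Scope ring_scope.
Local Open Scope complex_scope.

(** An element {f + r, f' + r'} of the extension [At], split along the range of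
    [iota] and its orthogonal complement, has {f, f'} in A^*.  Attaching to the
    exit part (r, r') the boundary values (h, h') = (G0 f, - G1 f) gives the
    relation [coupling].  Self-adjointness of [At] says two things about it:
    any two of its elements satisfy the Green identity
      (r', s) - (r, s') = (h', k) - (h, k')      ([coupling_green]),
    and every pair satisfying that identity against all of it belongs to it
    ([coupling_maximal]).  The prescribed compressed resolvents say that, off
    the real axis, the pairs (h, h') coupled with some (r, l r) include
    tau(l) ([coupling_weyl]).  The theorem describes which pairs are coupled
    with some (r, t r) for real t.

    With l = t + iy, y > 0, let g(y) h be the vector coupled with
    (h, tau0(l) h), for h in M = orth K.  Green's identity becomes
      i (y + x) (g(y) h, g(x) k) = (tau0(t + iy) h, k) - (h, tau0(t + ix) k),
    and expanding |g(y) h - g(x) h|^2 with it yields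
      (y + x) |g(y) h - g(x) h|^2 = (x - y) (|g(y) h|^2 - |g(x) h|^2)
    as well as the analogous formula with the opposite sign for the family
    y g(y) h.  So the norms are monotone in y, and each family is Cauchy at 0+
    as soon as its norm stays bounded.  Hence y g(y) h always has a limit
    [residue], whose Gram form is that of the operator B(t), whereas
    g(y) h converges exactly when Im (tau0(t + iy) h, h) / y = |g(y) h|^2 does,
    that is, for h in dom D(t); in that case tau0(t + iy) h converges too, from
    both sides of the real axis, because the limit of g(y) h is orthogonal to
    all residues.

    If (h, h') is coupled with (r, t r), Green's identity against g(y) h bounds
    |g(y) h| by |r|, so h is in dom D(t); against g(y) k it gives
    (h' - D(t) h, k) = i (r, residue k) for k in M in the limit.  Projecting
    - i r onto the finite-dimensional space of residues produces h0 with
    - h' + D(t) h - B(t) h0 orthogonal to M, hence in K ([coupling_in_eta]).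
    Conversely, for an element of eta(t), the vector w + i v, with w the limit
    of g(y) h and v the residue of h0, satisfies Green's identity against the
    whole coupling relation, by passing to the limit, so maximality applies
    ([eta_green]).

    Weak limits in G are strong because dim G is finite; this is where the
    deficiency indices enter ([triplet_total]). *)

(** * Inner products and limits *)

Section Complex.
Variable R : realType.

Lemma conjcE (a b : R) : Num.conj (a +i* b : R[i]) = a -i* b.
Proof. by []. Qed.

Lemma conjcR (r : R) : Num.conj (r%:C : R[i]) = r%:C.
Proof. by rewrite [LHS]conjcE oppr0. Qed.

Lemma conj_i : Num.conj ('i : R[i]) = - 'i.
Proof. by apply/eqP; rewrite eq_complex /= oppr0 !eqxx. Qed.

Lemma mul_ii : 'i * 'i = -1 :> R[i].
Proof. by apply/eqP; rewrite eq_complex /=; apply/andP; split; apply/eqP; ring. Qed.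

Lemma subspaceZ (W : lmodType R[i]) (M : set W) a u :
  is_subspace M -> M u -> M (a *: u).
Proof. by move=> lM Mu; rewrite -[_ *: _]addr0; apply: lM.2 => //; exact: lM.1. Qed.

Lemma subspaceB (W : lmodType R[i]) (M : set W) u v :
  is_subspace M -> M u -> M v -> M (u - v).
Proof. by move=> lM Mu Mv; rewrite addrC -scaleN1r; apply: lM.2. Qed.

End Complex.

Section InnerProduct.
Variables (R : realType) (V : hilbertType R).
Implicit Types (x y z : V) (a b : R[i]).

Lemma hdotC x y : hdot y x = Num.conj (hdot x y).
Proof. by rewrite (hermC (@hdot R V)) expr0 mul1r. Qed.

Lemma hdotDl x y z : hdot (x + y) z = hdot x z + hdot y z.
Proof. by rewrite linearDl. Qed.

Lemma hdotZl a x z : hdot (a *: x) z = a * hdot x z.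
Proof. by rewrite linearZl_LR. Qed.

Lemma hdotDr x y z : hdot z (x + y) = hdot z x + hdot z y.
Proof. by rewrite linearDr. Qed.

Lemma hdotZr a x z : hdot z (a *: x) = Num.conj a * hdot z x.
Proof. by rewrite linearZr. Qed.

Lemma hdotNl x z : hdot (- x) z = - hdot x z.
Proof. by rewrite linearNl. Qed.

Lemma hdotNr x z : hdot z (- x) = - hdot z x.
Proof. by rewrite linearNr. Qed.

Lemma hdot0l z : hdot 0 z = 0.
Proof. by rewrite linear0l. Qed.

Lemma hdot0r z : hdot z 0 = 0.
Proof. by rewrite linear0r. Qed.

(** The norm takes its values in [R[i]]; its square is kept here as an element of
    the ordered field [R], where the estimates are made. *)
Definition sqn x : R := complex.Re (hdot x x).

Lemma hdotxx x : hdot x x = (sqn x)%:C.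
Proof.
rewrite /sqn; have := hdotC x x; case: (hdot x x) => a b.
rewrite conjcE => -[] /eqP; rewrite -subr_eq0 opprK -mulr2n mulrn_eq0 /= => /eqP ->.
by [].
Qed.

Lemma sqn_ge0 x : 0 <= sqn x.
Proof. by rewrite -ler0c -hdotxx -hdot_norm exprn_ge0. Qed.

Lemma sqn_eq0 x : sqn x = 0 -> x = 0.
Proof. by move=> x0; apply/eqP; rewrite -normr_eq0 -sqrf_eq0 hdot_norm hdotxx x0. Qed.

Lemma sqnZ a x : sqn (a *: x) = complex.Re (a * Num.conj a) * sqn x.
Proof.
by rewrite /sqn hdotZl hdotZr mulrA hdotxx; case: a => a1 a2; rewrite conjcE; simpc; rewrite /=; ring.
Qed.

Lemma sqnB x y : sqn (x - y) = sqn x + sqn y - (complex.Re (hdot x y)) *+ 2.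
Proof.
rewrite /sqn hdotDl !hdotDr !hdotNl !hdotNr (hdotC x y).
case: (hdot x y) => a b; rewrite conjcE !hdotxx; simpc; rewrite /=; ring.
Qed.

Lemma sqnN x : sqn (- x) = sqn x.
Proof. by rewrite /sqn hdotNl hdotNr opprK. Qed.

Lemma parallelogram x y : sqn (x + y) + sqn (x - y) = (sqn x + sqn y) *+ 2.
Proof. by rewrite -{1}(opprK y) !sqnB hdotNr sqnN; case: hdot => a b /=; ring. Qed.

Section Limits.
Context {T : Type} {F : set_system T}.

Lemma lt_norm_sqn (e : R) x : 0 < e -> (`|x| < e%:C) = (sqn x < e ^+ 2).
Proof.
move=> e0; rewrite -(@ltr_pXn2r _ 2%N) ?nnegrE ?normr_ge0 ?ler0c ?ltW //.
by rewrite hdot_norm hdotxx -rmorphXn /= ltcR.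
Qed.

Lemma cvg_sqnP {FF : Filter F} (u : T -> V) l :
  u @ F --> l <-> (fun i => sqn (u i - l)) @ F --> (0 : R).
Proof.
split=> [ul|ul].
- apply/cvgrPdist_lt => e e0.
  have e'0 : (0 : R[i]) < (Num.sqrt e)%:C by rewrite ltcR sqrtr_gt0.
  move/cvgrPdist_lt: ul => /(_ _ e'0); apply: filterS => i.
  rewrite lt_norm_sqn ?sqrtr_gt0// sqr_sqrtr ?ltW// => h.
  by rewrite sub0r normrN ger0_norm ?sqn_ge0// -sqnN opprB.
- apply/cvgrPdist_lt => -[e e'] /[dup]; rewrite {1}ltcE /= => /andP[/eqP -> e0] _.
  move/cvgrPdist_lt: ul => /(_ _ (exprn_gt0 2 e0)); apply: filterS => i.
  rewrite lt_norm_sqn// sub0r normrN ger0_norm ?sqn_ge0// => h.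
  by rewrite -sqnN opprB.
Qed.

Lemma cvg_realC {FF : Filter F} (c : T -> R) (l : R) :
  c @ F --> l -> (fun i => (c i)%:C : R[i]^o) @ F --> (l%:C : R[i]^o).
Proof.
move=> cl; apply/cvgrPdist_lt => -[e e'] /[dup]; rewrite {1}ltcE /= => /andP[/eqP -> e0] _.
move/cvgrPdist_lt: cl => /(_ _ e0); apply: filterS => i h.
by rewrite -rmorphB /= normc_def /= expr0n addr0 sqrtr_sqr ltcR.
Qed.

Lemma cvg_Re {FF : Filter F} (c : T -> R[i]^o) (l : R[i]^o) :
  c @ F --> l -> (fun i => complex.Re (c i)) @ F --> complex.Re l.
Proof.
move=> cl; apply/cvgrPdist_lt => e e0.
have e'0 : (0 : R[i]) < e%:C by rewrite ltcR.
move/cvgrPdist_lt: cl => /(_ _ e'0); apply: filterS => i h.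
rewrite -ltcR; apply: le_lt_trans h.
have -> : complex.Re l - complex.Re (c i) = complex.Re (l - c i : R[i]).
  by case: (l) (c i) => ? ? [].
exact: normc_ge_Re.
Qed.

Lemma cvg_conj {FF : Filter F} (c : T -> R[i]^o) (l : R[i]^o) :
  c @ F --> l -> (fun i => Num.conj (c i : R[i]) : R[i]^o) @ F --> (Num.conj (l : R[i]) : R[i]^o).
Proof.
move=> cl; apply/cvgrPdist_lt => e e0.
move/cvgrPdist_lt: cl => /(_ _ e0); apply: filterS => i h.
by rewrite -rmorphB norm_conjC.
Qed.

(** By polarization the inner product is a combination of four squared norms,
    and the norm is continuous. *)
Lemma cvg_hdot {FF : Filter F} (u v : T -> V) x y : u @ F --> x -> v @ F --> y ->
  (fun i => hdot (u i) (v i) : R[i]^o) @ F --> (hdot x y : R[i]^o).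
Proof.
move=> ua vb.
pose q (p r : V) : R[i] := `|p + r| ^+ 2 - `|p - r| ^+ 2 +
  'i * (`|p + 'i *: r| ^+ 2 - `|p - 'i *: r| ^+ 2).
have qE (p r : V) : hdot p r = 4^-1 * q p r.
  rewrite /q !hdot_norm !hdotDl !hdotDr !hdotNl !hdotNr !hdotZl !hdotZr.
  have n4 : (4 : R[i]) != 0 by rewrite pnatr_eq0.
  rewrite conj_i; have i2 := mul_ii R; by field: i2; rewrite ?n4.
have cn (w : T -> V) z : w @ F --> z -> (fun i => `|w i| ^+2 : R[i]^o) @ F --> (`|z| ^+ 2 : R[i]^o).
  move=> wz; have wn : (fun i => `|w i| : R[i]^o) @ F --> (`|z| : R[i]^o) by exact: cvg_norm.
  exact: (@cvgM R[i] T F FF _ _ _ _ wn wn).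
rewrite qE; have uvE : (fun i => 4^-1 * q (u i) (v i) : R[i]^o) = fun i => hdot (u i) (v i).
  by apply/funext => i; rewrite qE.
rewrite -uvE.
have iv : (fun i => 'i *: v i) @ F --> 'i *: y by exact: cvgZl_tmp.
apply: (@cvgM R[i] T F FF (fun=> 4^-1)); first exact: cvg_cst.
apply: (@cvgD R[i] R[i]^o).
  by apply: (@cvgB R[i] R[i]^o); apply: cn; [exact: cvgD|exact: cvgB].
apply: (@cvgM R[i] T F FF (fun=> 'i)); first exact: cvg_cst.
by apply: (@cvgB R[i] R[i]^o); apply: cn; [exact: cvgD|exact: cvgB].
Qed.

End Limits.

End InnerProduct.

(** * Orthogonal projections *)

Section Projection.
Variables (R : realType) (V : hilbertType R).
Implicit Types (x y z : V) (a b : R[i]).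

(** Completeness, for families whose mutual distances are controlled by a
    quantity that vanishes along the filter; it serves sequences as well as
    families indexed by y -> 0+. *)
Lemma cvg_cauchy_sqn (T : Type) (F : set_system T) {FF : ProperFilter F}
    (D : set T) (u : T -> V) (c : T -> R) :
  F D -> (forall i j, D i -> D j -> sqn (u i - u j) <= `|c i| + `|c j|) ->
  c @ F --> (0 : R) -> exists l : V, u @ F --> l.
Proof.
move=> FD uc c0.
suff : cvg (u @ F) by move=> h; exists (lim (u @ F)).
apply/cauchy_cvgP; apply/cauchy_ballP => e e0.
move: (e) e0 => -[{}e e'] /[dup]; rewrite {1}ltcE /= => /andP[/eqP -> e0] _.
have e20 : 0 < e ^+ 2 / 2 by rewrite divr_gt0 ?exprn_gt0.
move/cvgrPdist_lt: c0 => /(_ _ e20) c0.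
exists (u @` (D `&` [set i | `|0 - c i| < e ^+ 2 / 2]),
        u @` (D `&` [set i | `|0 - c i| < e ^+ 2 / 2])) => /=.
  have FI : F (D `&` [set i | `|0 - c i| < e ^+ 2 / 2]) by exact: filterI.
  by split; apply: (@filterS T F _ _ _ _ FI) => i h; exists i.
move=> [p q] /= [[i [Di ci] <-] [j [Dj cj] <-]].
rewrite -ball_normE /ball_ /= lt_norm_sqn //; apply: le_lt_trans (uc _ _ Di Dj) _.
by move: ci cj; rewrite /= !sub0r !normrN; lra.
Qed.

(** The projection theorem.  A sequence in [M] minimizing the distance to [x] is
    Cauchy by the parallelogram law.  At its limit [p], moving along [y] in [M]
    by (x - p, y) / (y, y) would shorten x - p by |(x - p, y)|^2 / (y, y), so
    this inner product vanishes. *)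
Lemma orth_decomp (M : set V) x : is_subspace M -> closed M ->
  exists2 p, M p & orth M (x - p).
Proof.
move=> [M0 Ml] cM.
pose S := [set sqn (x - m) | m in M].
have Sl : lbound S 0 by move=> _ [m _ <-]; exact: sqn_ge0.
have S0 : has_inf S by split; [exists (sqn (x - 0)), 0|exists 0].
set d := inf S.
have dle m : M m -> d <= sqn (x - m) by move=> Mm; apply: ge_inf; [exists 0|exists m].
have /choice[m mP] : forall n : nat, exists m, M m /\ sqn (x - m) < d + n.+1%:R^-1.
  move=> n; have n0 : 0 < n.+1%:R^-1 :> R by rewrite invr_gt0.
  have [_ [m Mm <-] lt] := inf_adherent n0 S0.
  by exists m.
(* The midpoint of [m i] and [m j] is in [M], hence at squared distance at
   least [d] from [x]. *)
have Mh p q : M p -> M q -> M (2^-1 *: (p + q)).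
  move=> Mp Mq; rewrite -[_ *: _]addr0; apply: (Ml) => //.
  by rewrite -[p]scale1r; apply: (Ml).
have [p mp] : exists p : V, m @ \oo --> p.
  apply: (@cvg_cauchy_sqn _ \oo _ setT m (fun n => 2 * n.+1%:R^-1)).
  - exact: filterT.
  - move=> i j _ _; rewrite !ger0_norm ?mulr_ge0 ?invr_ge0 //.
    have [[Mi di] [Mj dj]] := (mP i, mP j).
    have := dle _ (Mh _ _ Mi Mj).
    have -> : sqn (x - 2^-1 *: (m i + m j)) = 4^-1 * sqn ((x - m i) + (x - m j)).
      rewrite -[x in LHS](_ : 2^-1 *: (x + x) = x); last first.
        rewrite -mulr2n -[x *+ 2]scaler_nat.
        by rewrite scalerA mulVf ?scale1r// pnatr_eq0.
      rewrite -scalerBr sqnZ opprD addrACA; congr (_ * _).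
      have -> : Num.conj (2^-1 : R[i]) = 2^-1 by rewrite fmorphV rmorph_nat.
      have -> : (2^-1 : R[i]) = (2^-1 : R)%:C by rewrite fmorphV rmorph_nat.
      by rewrite -rmorphM /= -invfM -natrM.
    have := parallelogram (x - m i) (x - m j).
    have -> : x - m i - (x - m j) = - (m i - m j) by rewrite opprB addrC addrA subrK opprB.
    rewrite sqnN mulr2n; move: di dj; move: i.+1%:R^-1 j.+1%:R^-1 => u v.
    lra.
  - rewrite -[0](mulr0 2); apply: cvgMl_tmp; exact: cvg_harmonic.
have Mp : M p by apply: (closed_cvg _ cM _ _ mp); apply: nearW => n; exact: (mP n).1.
have dp : sqn (x - p) <= d.
  have c1 : (fun n => sqn (x - m n)) @ \oo --> sqn (x - p).
    by apply: cvg_Re; apply: cvg_hdot; apply: cvgB => //; exact: cvg_cst.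
  have c2 : (fun n : nat => d + n.+1%:R^-1) @ \oo --> d + 0.
    by apply: cvgD; [exact: cvg_cst|exact: cvg_harmonic].
  rewrite -[d]addr0; apply: ler_cvg_to c1 c2 _.
  by apply: nearW => n; apply: ltW; exact: (mP n).2.
exists p => // y My.
set a := hdot (x - p) y.
have [s0|s0] := eqVneq (sqn y) 0; first by rewrite /a (sqn_eq0 s0) hdot0r.
have := dle _ (Ml ((sqn y)^-1%:C * a) _ _ My Mp).
have -> : x - ((sqn y)^-1%:C * a *: y + p) = (x - p) - (sqn y)^-1%:C * a *: y.
  by rewrite opprD addrCA addrC.
rewrite sqnB sqnZ hdotZr -/a => dp'.
have {}dp' := le_trans dp dp'; move: dp'.
have sy : 0 < sqn y by rewrite lt_def s0 sqn_ge0.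
case: a => a1 a2.
have -> : (sqn y)^-1%:C * (a1 +i* a2) = (sqn y)^-1 * a1 +i* ((sqn y)^-1 * a2) by simpc.
rewrite conjcE; simpc => /=.
(* The right side of [h] is |x - p|^2 - |a|^2 / |y|^2. *)
set s := sqn y => h.
have : 0 <= - ((a1 ^+ 2 + a2 ^+ 2) / s).
  move: h; rewrite -[X in X <= _]addr0 -addrA lerD2l; congr (_ <= _).
  by field; exact: s0.
rewrite oppr_ge0 pmulr_lle0 ?invr_gt0// => h'.
have /eqP : a1 ^+ 2 + a2 ^+ 2 = 0 by apply/eqP; rewrite eq_le h' addr_ge0 ?sqr_ge0.
by rewrite paddr_eq0 ?sqr_ge0// !sqrf_eq0 => /andP[/eqP -> /eqP ->].
Qed.

(** The orthogonal projection of [x] onto the span of [s] when [s] is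
    orthonormal. *)
Definition fourier_sum (s : seq V) x := \sum_(e <- s) hdot x e *: e.

Lemma sum_subspace (M : set V) (s : seq V) (f : V -> R[i]) : is_subspace M ->
  {in s, forall e, M e} -> M (\sum_(e <- s) f e *: e).
Proof.
move=> [M0 Ml]; elim: s => [|e s IH] sM; first by rewrite big_nil.
rewrite big_cons; apply: (Ml); first by apply: sM; rewrite mem_head.
by apply: IH => w ws; apply: sM; rewrite in_cons ws orbT.
Qed.

(** Orthonormality of [t] is replaced by the property for which it is used: the
    error of the Fourier sum is orthogonal to [s].  The induction also carries
    the orthogonality of this error to [t] itself, by which the next vector is
    orthogonal to the previous ones. *)
Lemma gram_schmidt (M : set V) (s : seq V) : is_subspace M ->
  {in s, forall w, M w} ->
  exists2 t : seq V, {in t, forall e, M e} &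
    forall x, {in s, forall w, hdot (x - fourier_sum t x) w = 0}.
Proof.
move=> sM.
suff H : {in s, forall w, M w} -> exists2 t : seq V, {in t, forall e, M e} &
    forall x, {in s, forall w, hdot (x - fourier_sum t x) w = 0} /\
      {in t, forall w, hdot (x - fourier_sum t x) w = 0}.
  by move=> /H[t tM tP]; exists t => // x; exact: (tP x).1.
elim: s => [|w s IH] wM; first by exists [::].
have [|t tM tP] := IH; first by move=> e es; apply: wM; rewrite in_cons es orbT.
set r := w - fourier_sum t w.
have rt e : e \in t -> hdot r e = 0 by exact: (tP w).2.
have rtx x : hdot r (fourier_sum t x) = 0.
  rewrite linear_sumr big_seq big1 // => e et /=.
  by rewrite hdotZr rt ?mulr0.
have Mw : M w by apply: wM; rewrite mem_head.
(* A vector [w] already in the span of [t] adds nothing. *)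
have [r0|r0] := eqVneq (sqn r) 0.
  exists t => // x; split; last exact: (tP x).2.
  move=> e; rewrite in_cons => /predU1P[->|]; last exact: (tP x).1.
  have -> : w = fourier_sum t w by apply/subr0_eq; exact: sqn_eq0.
  rewrite linear_sumr big_seq big1 // => k kt /=.
  by rewrite hdotZr (tP x).2 ?mulr0.
have rgt : 0 < sqn r by rewrite lt_def r0 sqn_ge0.
set q := (Num.sqrt (sqn r))^-1%:C *: r.
have qq : hdot q q = 1.
  by rewrite hdotxx sqnZ conjcR -rmorphM /= -expr2 exprVn sqr_sqrtr ?mulVf// ltW.
have tq x : hdot (fourier_sum t x) q = 0 by rewrite hdotZr [X in _ * X]hdotC rtx rmorph0 mulr0.
have qt e : e \in t -> hdot q e = 0 by move=> et; rewrite hdotZl rt ?mulr0.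
have Mr : M r.
  by apply: subspaceB => //; exact: sum_subspace.
exists (q :: t) => [e|x].
  rewrite in_cons => /predU1P[->|]; last exact: tM.
  exact: subspaceZ.
have E : x - fourier_sum (q :: t) x = x - fourier_sum t x - hdot x q *: q.
  by rewrite /fourier_sum big_cons opprD addrCA addrC.
have Pt : {in t, forall k, hdot (x - fourier_sum (q :: t) x) k = 0}.
  by move=> k kt; rewrite E hdotDl (tP x).2// hdotNl hdotZl qt// mulr0 oppr0 addr0.
have Pq : hdot (x - fourier_sum (q :: t) x) q = 0.
  by rewrite E !hdotDl !hdotNl tq oppr0 addr0 hdotZl qq mulr1 subrr.
split=> k; rewrite in_cons => /predU1P[->|ks].
- have -> : w = fourier_sum t w + (Num.sqrt (sqn r))%:C *: q.
    rewrite scalerA -rmorphM /= divff ?scale1r ?sqrtr_eq0 -?ltNge// /r.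
    by rewrite addrC subrK.
  rewrite hdotDr hdotZr Pq mulr0 addr0 linear_sumr big_seq big1// => e et /=.
  by rewrite hdotZr Pt ?mulr0.
- rewrite E hdotDl (tP x).1// hdotNl hdotZl.
  suff -> : hdot q k = 0 by rewrite mulr0 oppr0 addr0.
  have := (tP q).1 _ ks; rewrite /fourier_sum big_seq big1 ?subr0// => e et.
  by rewrite qt// scale0r.
- exact: Pq.
- exact: Pt.
Qed.

End Projection.

Section Subspaces.
Variable R : realType.
Implicit Types (V W : hilbertType R) (a b : R[i]).

Lemma orth_subspace V (M : set V) : is_subspace (orth M).
Proof.
split=> [y _|a u v Mu Mv y My]; first by rewrite hdot0l.
by rewrite hdotDl hdotZl Mu// Mv// mulr0 addr0.
Qed.

Lemma orth_sym V (M : set V) x y : orth M x -> M y -> hdot y x = 0.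
Proof. by move=> Mx My; rewrite hdotC Mx// rmorph0. Qed.

Lemma closed_seq (W : completeNormedModType R[i]) (M : set W) :
  (forall (u : nat -> W) l, (forall n, M (u n)) -> u @ \oo --> l -> M l) ->
  closed M.
Proof.
move=> seqM x Mx.
have nP (n : nat) : (0 : R[i]) < n.+1%:R^-1 by rewrite invr_gt0.
have /choice[u uP] : forall n : nat, exists y, M y /\ `|x - y| < n.+1%:R^-1.
  move=> n; have [y [My xy]] := Mx _ (nbhsx_ballx x _ (nP n)).
  by exists y; split=> //; move: xy; rewrite -ball_normE.
apply: (seqM u) => [n|]; first exact: (uP n).1.
apply/cvgrPdist_lt => -[e e'] /[dup]; rewrite {1}ltcE /= => /andP[/eqP -> e0] _.
have /cvgrPdist_lt/(_ e e0) := @cvg_harmonic R.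
apply: filterS => n; rewrite sub0r normrN ger0_norm ?invr_ge0// /harmonic => ne.
apply: lt_trans (uP n).2 _.
rewrite (_ : n.+1%:R^-1 = (n.+1%:R^-1)%:C :> R[i]) ?ltcR//.
by rewrite fmorphV rmorph_nat.
Qed.

Lemma orth_closed V (M : set V) : closed (orth M).
Proof.
apply: closed_seq => u l uM ul y My.
have c1 : (fun n => hdot (u n) y : R[i]^o) @ \oo --> (hdot l y : R[i]^o).
  by apply: cvg_hdot => //; exact: cvg_cst.
have c0 : (fun n => hdot (u n) y : R[i]^o) = fun=> 0 by apply/funext => n; exact: uM.
rewrite c0 in c1.
exact: (cvg_unique (@norm_hausdorff _ R[i]^o) c1 (cvg_cst _)).
Qed.

(** A convergent family is Cauchy, and [h] inherits this from [u]. *)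
Lemma cvg_dominated V W (T : Type) (F : set_system T) {FF : ProperFilter F}
    (u : T -> V) (h : T -> W) (l : V) :
  (forall i j, sqn (h i - h j) <= sqn (u i - u j)) ->
  u @ F --> l -> exists k : W, h @ F --> k.
Proof.
move=> hu /cvg_sqnP ul.
apply: (@cvg_cauchy_sqn _ _ _ _ _ setT h (fun i => 2 * sqn (u i - l))).
- exact: filterT.
- move=> i j _ _; apply: le_trans (hu i j) _.
  rewrite !ger0_norm ?mulr_ge0 ?sqn_ge0//.
  have := parallelogram (u i - l) (u j - l).
  have -> : u i - l - (u j - l) = u i - u j by rewrite opprB addrA subrK.
  rewrite mulr2n; have := sqn_ge0 (u i - l + (u j - l)); lra.
- by rewrite -[0](mulr0 2); apply: cvgMl_tmp.
Qed.

(** Preimages of a convergent sequence in the range form a Cauchy sequence. *)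
Lemma closed_isometry V W (f : V -> W) :
  (forall x y, sqn (x - y) <= sqn (f x - f y)) -> continuous f ->
  closed (range f).
Proof.
move=> iso cf; apply: closed_seq => u l uf ul.
have /choice[h hP] : forall n, exists x, f x = u n by move=> n; have [x _] := uf n; exists x.
have [k hk] : exists k : V, h @ \oo --> k.
  by apply: (cvg_dominated _ ul) => i j; rewrite -!hP.
exists k => //.
have fk : (f \o h) @ \oo --> f k by apply: continuous_cvg => //; exact: cf.
have fhu : f \o h = u by apply/funext => n /=.
rewrite fhu in fk; exact: (cvg_unique (@norm_hausdorff _ W) fk ul).
Qed.

(** Orthonormalizing the projections onto [M] of the total family gives a finite
    orthonormal basis of [M]. *)
Lemma frame_of_total V (M : set V) (s : seq V) : is_subspace M -> closed M ->
  (forall x, {in s, forall w, hdot x w = 0} -> x = 0) ->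
  exists2 t : seq V, {in t, forall e, M e} & forall x, M x -> x = fourier_sum t x.
Proof.
move=> sM cM tot.
have /choice[p pP] : forall w, exists p, M p /\ orth M (w - p).
  by move=> w; have [p] := orth_decomp w sM cM; exists p.
have [|t tM tP] := @gram_schmidt _ _ M (map p s) sM.
  by move=> _ /mapP[w _ ->]; exact: (pP w).1.
exists t => // x Mx; apply/subr0_eq/tot => w ws.
have Md : M (x - fourier_sum t x).
  by apply: subspaceB => //; exact: sum_subspace.
rewrite -[w](subrK (p w)) hdotDr (orth_sym (pP w).2 Md) add0r.
by apply: tP; apply: map_f.
Qed.

(** In finite dimension weak convergence implies convergence: the [u i] are
    finite sums with convergent coefficients. *)
Lemma cvg_frame V (T : Type) (F : set_system T) {FF : Filter F} (M : set V) (t : seq V)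
    (u : T -> V) (c : V -> R[i]) :
  (forall x, M x -> x = fourier_sum t x) ->
  (\forall i \near F, M (u i)) ->
  {in t, forall e, (fun i => hdot (u i) e : R[i]^o) @ F --> (c e : R[i]^o)} ->
  u @ F --> \sum_(e <- t) c e *: e.
Proof.
move=> tP Mu uc.
have : (fun i => fourier_sum t (u i)) @ F --> \sum_(e <- t) c e *: e.
  rewrite /fourier_sum; elim: t uc {tP Mu} => [|e t IH] uc.
    under eq_fun do rewrite big_nil; rewrite big_nil; exact: cvg_cst.
  under eq_fun do rewrite big_cons; rewrite big_cons.
  apply: cvgD; last by apply: IH => k kt; apply: uc; rewrite in_cons kt orbT.
  by apply: (@cvgZr_tmp R[i] V T F FF); apply: uc; rewrite mem_head.
apply: cvg_trans; apply: near_eq_cvg.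
by apply: filterS Mu => i Mi; rewrite -tP.
Qed.

End Subspaces.

(** * Boundary triplets with finite deficiency indices *)

Section SymmetricRelation.
Variables (R : realType) (H : hilbertType R).
Implicit Types (A : set (H * H)) (a b : R[i]).

Lemma rel_adj_subspace A : is_subspace (rel_adj A).
Proof.
split=> [p _|a u v Au Av p Ap]; first by rewrite !hdot0r.
by rewrite /= !hdotDr !hdotZr Au// Av.
Qed.

Definition range_plus_i A : set H := [set p.2 + 'i *: p.1 | p in A].

(** The cross term is 2 Im (p', p), which vanishes on a symmetric relation. *)
Lemma sqn_plus_i A p : rel_symmetric A -> A p -> sqn (p.2 + 'i *: p.1) = sqn p.2 + sqn p.1.
Proof.
move=> sA Ap; rewrite -[_ *: _]opprK sqnB hdotNr hdotZr conj_i sqnN sqnZ conj_i.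
have := hdotC p.1 p.2; rewrite -(sA _ Ap _ Ap).
case: (hdot p.2 p.1) => c d; rewrite conjcE => -[] /eqP.
rewrite -subr_eq0 opprK -mulr2n mulrn_eq0 /= => /eqP ->.
by simpc => /=; ring.
Qed.

Lemma range_plus_i_subspace A : is_subspace A -> is_subspace (range_plus_i A).
Proof.
move=> sA; split; first by exists 0; [exact: sA.1|rewrite /= scaler0 addr0].
move=> a _ _ [p Ap <-] [q Aq <-]; exists (a *: p + q); first exact: sA.2.
by rewrite /= !scalerDr !scalerA [_ * a]mulrC addrACA.
Qed.

(** By [sqn_plus_i] both components of p in A are controlled by p' + i p, so
    closedness of [A] passes to the range. *)
Lemma closed_range_plus_i A : is_subspace A -> closed A -> rel_symmetric A ->
  closed (range_plus_i A).
Proof.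
move=> lA cA sA; apply: closed_seq => u l uA ul.
have /choice[p pP] : forall n, exists p, A p /\ p.2 + 'i *: p.1 = u n.
  by move=> n; have [p] := uA n; exists p.
have pu i j : sqn (u i - u j) = sqn ((p i).2 - (p j).2) + sqn ((p i).1 - (p j).1).
  rewrite -(pP i).2 -(pP j).2 -(sqn_plus_i sA (subspaceB lA (pP i).1 (pP j).1)) /=.
  by congr sqn; rewrite scalerBr opprD addrACA.
have [k1 hk1] : exists k1 : H, (fst \o p) @ \oo --> k1.
  by apply: (cvg_dominated _ ul) => i j; rewrite pu lerDr sqn_ge0.
have [k2 hk2] : exists k2 : H, (snd \o p) @ \oo --> k2.
  by apply: (cvg_dominated _ ul) => i j; rewrite pu lerDl sqn_ge0.
exists (k1, k2) => /=.
  apply: (@closed_cvg nat (H * H)%type \oo _ (fun n => ((p n).1, (p n).2)) A cA).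
    by apply: nearW => n; rewrite -surjective_pairing; exact: (pP n).1.
  exact: cvg_pair.
have hk : (fun n => (p n).2 + 'i *: (p n).1) @ \oo --> k2 + 'i *: k1.
  by apply: cvgD => //; exact: cvgZl_tmp.
have fhu : (fun n => (p n).2 + 'i *: (p n).1) = u by apply/funext => n; exact: (pP n).2.
rewrite fhu in hk; exact: (cvg_unique (@norm_hausdorff _ H) hk ul).
Qed.

Section Triplet.
Variables (G : hilbertType R) (A : set (H * H)) (G0 G1 : H * H -> G).
Hypotheses (sA : rel_symmetric A) (bt : boundary_triplet A G0 G1).

Lemma linear_onB (W W' : lmodType R[i]) (M : set W) (F : W -> W') u v :
  linear_on M F -> M u -> M v -> F (u - v) = F u - F v.
Proof. by move=> lF Mu Mv; rewrite addrC -scaleN1r lF// scaleN1r addrC. Qed.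

(** Against an element of [A] the left side of Green's identity vanishes on all
    of A^*, and the boundary values fill [G * G]. *)
Lemma triplet_vanish p : A p -> G0 p = 0 /\ G1 p = 0.
Proof.
move=> Ap; have Asp := sA Ap.
have gr q : rel_adj A q -> hdot (G1 p) (G0 q) = hdot (G0 p) (G1 q).
  move=> Aq; apply/eqP; rewrite -subr_eq0 -(bt_green bt)// subr_eq0; apply/eqP.
  exact: Aq.
have [q Aq [q0 q1]] := bt_surjective bt (0, G0 p).
have [r Ar [r0 r1]] := bt_surjective bt (G1 p, 0).
split; apply: sqn_eq0; rewrite /sqn.
  by rewrite -{2}q1 -gr// q0 hdot0r.
by rewrite -{2}r0 gr// r1 hdot0r.
Qed.

(** [G] is finite-dimensional: the vectors [G0 (e_j, i e_j)], for a basis [e_j]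
    of ker (A^* - i), form a total family.  If [x] is orthogonal to them,
    take f in A^* with boundary values (0, x).  Green's identity makes f' + i f
    orthogonal to ker (A^* - i), so f' + i f lies in the closed range of A + i.
    Subtracting a suitable element of [A] from f leaves d with d' = - i d and
    G0 d = 0, and Green's identity for the pair (d, d) forces d = 0. *)
Lemma triplet_total n : is_subspace A -> closed A -> deficiency_plus A n ->
  exists s : seq G, forall x, {in s, forall w, hdot x w = 0} -> x = 0.
Proof.
move=> lA cA dA.
have i0 : 0 < complex.Im ('i : R[i]) by rewrite /= ltr01.
have [e [_ eE]] := dA _ i0.
exists [seq G0 (e j, 'i *: e j) | j <- enum 'I_n] => x xs.
have eker j : rel_ker (rel_sub (rel_adj A) 'i) (e j).
  rewrite eE /=; exists (fun k => (k == j)%:R).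
  rewrite (bigD1 j)//= eqxx scale1r big1 ?addr0// => k /negPf ->.
  by rewrite scale0r.
have kerP q : rel_ker (rel_sub (rel_adj A) 'i) q <-> rel_adj A (q, 'i *: q).
  split=> [[[q1 q2] /= Aq [-> /eqP]]|Aq].
    by rewrite eq_sym subr_eq0 => /eqP <-.
  by exists (q, 'i *: q) => //=; rewrite subrr.
have [f Af [f0 f1]] := bt_surjective bt (0, x).
have fe j : hdot (f.2 + 'i *: f.1) (e j) = 0.
  have := bt_green bt Af ((kerP _).1 (eker j)).
  rewrite f0 f1 hdot0l subr0 xs; last by apply: map_f; rewrite mem_enum.
  by rewrite /= hdotZr conj_i mulNr opprK hdotDl hdotZl.
have [_ [a Aa <-] aq] := orth_decomp (f.2 + 'i *: f.1)
  (range_plus_i_subspace lA) (closed_range_plus_i lA cA sA).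
set q := f.2 + 'i *: f.1 - (a.2 + 'i *: a.1) in aq.
have q0 : q = 0.
  have : rel_ker (rel_sub (rel_adj A) 'i) q.
    apply/kerP => p Ap /=; have := orth_sym aq (ex_intro2 _ _ p Ap erefl).
    by rewrite hdotDl hdotZl hdotZr conj_i mulNr => /eqP; rewrite addr_eq0 => /eqP.
  rewrite eE => -[c qE].
  apply: sqn_eq0; rewrite /sqn {1}/q hdotDl hdotNl (orth_sym aq _ : hdot (a.2 + 'i *: a.1) q = 0);
    last by exists a.
  rewrite oppr0 addr0.
  by rewrite qE linear_sumr big1// => j _ /=; rewrite hdotZr fe mulr0.
have [a0 a1] := triplet_vanish Aa; have Asa := sA Aa.
have Ad : rel_adj A (f - a).
  exact: (subspaceB (rel_adj_subspace A)).
have d0 : G0 (f - a) = 0 by rewrite (linear_onB (bt_linear0 bt))// f0 a0 subr0.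
have d2 : (f - a).2 = - 'i *: (f - a).1.
  apply/eqP; rewrite scaleNr -addr_eq0 /= scalerBr addrACA -opprD.
  by apply/eqP; exact: q0.
have := bt_green bt Ad Ad; rewrite d0 hdot0l hdot0r subrr d2 hdotZl hdotZr.
rewrite rmorphN /= conj_i opprK hdotxx => /eqP.
rewrite mulNr -opprD oppr_eq0 -mulr2n mulrn_eq0 /= mulf_eq0 => /orP[/eqP[/eqP]|/eqP[/sqn_eq0]].
  by rewrite oner_eq0.
move=> d10.
have fa : f = a by apply/subr0_eq; rewrite [f - a]surjective_pairing d2 /= d10 scaler0.
by rewrite -f1 fa.
Qed.

End Triplet.
End SymmetricRelation.

(** * The coupling relation in the exit space *)

Section ExitSpace.
Variables (R : realType) (H Ht : hilbertType R) (iota : {linear H -> Ht}).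
Hypothesis iso : is_isometry iota.

Lemma isometry_sqn x y : sqn (iota x - iota y) = sqn (x - y).
Proof. by rewrite -linearB /sqn iso. Qed.

Lemma isometry_closed_range : closed (range iota).
Proof.
apply: closed_isometry => [x y|x]; first by rewrite isometry_sqn.
apply/cvg_sqnP; under eq_fun do rewrite isometry_sqn.
by apply/cvg_sqnP.
Qed.

Lemma range_subspace : is_subspace (range iota).
Proof.
split; first by exists 0; rewrite ?linear0.
by move=> a _ _ [x _ <-] [y _ <-]; exists (a *: x + y); rewrite // linearP.
Qed.

Section Coupling.
Variables (G : hilbertType R) (A : set (H * H)) (G0 G1 : H * H -> G) (At : set (Ht * Ht)).
Hypothesis bt : boundary_triplet A G0 G1.
Hypothesis saAt : rel_selfadjoint At.
Hypothesis AAt : forall f, A f -> At (iota f.1, iota f.2).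

(** The minus sign in front of [G1] makes tau, rather than - tau, the Weyl family
    of this relation; in the terminology of boundary relations it is a unitary
    boundary relation for the part of the extension in the exit space. *)
Definition coupling (p : Ht * Ht) (q : G * G) : Prop :=
  exists f, [/\ rel_adj A f, orth (range iota) p.1 /\ orth (range iota) p.2,
    At (iota f.1 + p.1, iota f.2 + p.2), G0 f = q.1 & G1 f = - q.2].

Lemma hdot_exit f g (r s : Ht) : orth (range iota) r -> orth (range iota) s ->
  hdot (iota f + r) (iota g + s) = hdot f g + hdot r s.
Proof.
move=> Or Os; rewrite hdotDl !hdotDr iso (Or (iota g)) ?add0r; last by exists g.
by rewrite (orth_sym Os) ?addr0//; exists f.
Qed.

(** Elements of At = At^* satisfy the defining identity of the adjoint against
    [A], to which their exit parts do not contribute. *)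
Lemma exit_adj f p : orth (range iota) p.1 -> orth (range iota) p.2 ->
  At (iota f.1 + p.1, iota f.2 + p.2) -> rel_adj A f.
Proof.
move=> Q1 Q2; rewrite saAt => Af a /AAt /Af /=.
rewrite -{1}[iota a.2]addr0 -{1}[iota a.1]addr0.
have Q0 : orth (range iota) 0 by case: (orth_subspace (range iota)).
by rewrite !hdot_exit// !hdot0l !addr0.
Qed.

(** Symmetry of [At], from which Green's identity of the boundary triplet is
    subtracted. *)
Lemma coupling_green p q p' q' : coupling p q -> coupling p' q' ->
  hdot p.2 p'.1 - hdot p.1 p'.2 = hdot q.2 q'.1 - hdot q.1 q'.2.
Proof.
move=> [f [Af [Q1 Q2] Tf f0 f1]] [g [Ag [P1 P2] Tg g0 g1]].
move: Tg; rewrite saAt => /(_ _ Tf) /=; rewrite !hdot_exit// => E.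
have := bt_green bt Af Ag; rewrite f0 f1 g0 g1 hdotNl hdotNr opprK => E2.
have -> : hdot q.2 q'.1 - hdot q.1 q'.2 = - (hdot f.2 g.1 - hdot f.1 g.2) by rewrite E2; ring.
have -> : hdot f.2 g.1 = hdot f.1 g.2 + hdot p.1 p'.2 - hdot p.2 p'.1 by rewrite -E; ring.
by ring.
Qed.

(** Every element of [At] splits into an element of A^* and a coupled exit
    part; so the hypothesis together with Green's identity for [f] puts the pair
    in At^* = At.  It recognizes elements that are obtained as limits. *)
Lemma coupling_maximal f p : rel_adj A f ->
  orth (range iota) p.1 -> orth (range iota) p.2 ->
  (forall p' q', coupling p' q' ->
     hdot p'.2 p.1 - hdot p'.1 p.2 = hdot q'.2 (G0 f) + hdot q'.1 (G1 f)) ->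
  At (iota f.1 + p.1, iota f.2 + p.2).
Proof.
move=> Af Q1 Q2 fp; rewrite saAt => -[u1 u2] Tu /=.
have [_ [g1 _ <-] P1] := orth_decomp u1 range_subspace isometry_closed_range.
have [_ [g2 _ <-] P2] := orth_decomp u2 range_subspace isometry_closed_range.
set r1 := u1 - iota g1 in P1; set r2 := u2 - iota g2 in P2.
have E1 : u1 = iota g1 + r1 by rewrite addrC subrK.
have E2 : u2 = iota g2 + r2 by rewrite addrC subrK.
move: Tu; rewrite E1 E2 => Tu.
have Ag : rel_adj A (g1, g2) by exact: (@exit_adj (g1, g2) (r1, r2)).
have cpl : coupling (r1, r2) (G0 (g1, g2), - G1 (g1, g2)).
  by exists (g1, g2); split=> //=; rewrite opprK.
have /= E := fp _ _ cpl; rewrite hdotNl in E.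
have /= gr := bt_green bt Ag Af.
rewrite !hdot_exit//; apply/eqP; rewrite -subr_eq0; apply/eqP.
transitivity ((hdot g2 f.1 - hdot g1 f.2) + (hdot r2 p.1 - hdot r1 p.2)); first by ring.
by rewrite gr E; ring.
Qed.

(** The value of the compressed resolvent at f' - l f is f precisely when some
    exit vector r completes {f, f'} to {f + r, f' + l r} in [At]. *)
Lemma coupling_weyl (tau : R[i] -> set (G * G)) l q :
  compression iota (rel_inv (rel_sub At l)) =
    rel_inv (rel_sub (triplet_ext A G0 G1 (rel_opp (tau l))) l) ->
  tau l q -> exists r, coupling (r, l *: r) q.
Proof.
move=> cE tq.
have [f Af [f0 f1]] := bt_surjective bt (q.1, - q.2).
have : compression iota (rel_inv (rel_sub At l)) (f.2 - l *: f.1, f.1).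
  rewrite cE; exists (f.1, f.2 - l *: f.1) => //; exists f => //.
  by split=> //; exists q => //; rewrite f0 f1.
case=> g /= [[u1 u2] [[v1 v2] /= Tv [-> ->]] [E ->]] Qg.
exists (v1 - iota f.1); exists f; split=> //=.
  by split=> //; exact: subspaceZ (orth_subspace _) Qg.
have -> : iota f.1 + (v1 - iota f.1) = v1 by rewrite addrC subrK.
suff -> : iota f.2 + l *: (v1 - iota f.1) = v2 by [].
move: E; rewrite linearB linearZ /= => E.
by rewrite scalerBr addrCA E addrC subrK.
Qed.

End Coupling.
End ExitSpace.

(** * The gamma field near a real point *)

(** The families below are controlled for y > 0; the values at - y are obtained
    from them by taking adjoints. *)
Lemma cvg_dnbhs0_sym (R : realType) (T : topologicalType) (f : R -> T) (l : T) :
  f @ 0^'+ --> l -> (fun y => f (- y)) @ 0^'+ --> l -> f @ 0^' --> l.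
Proof.
move=> fr fl U Ul.
have [d /= d0 dU] := fr U Ul; have [e /= e0 eU] := fl U Ul.
have m0 : 0 < Num.min d e by rewrite lt_min d0.
exists (Num.min d e) => //= y; rewrite /ball_ /= sub0r normrN lt_min => /andP[yd ye] y0.
have [yp|yn|yE] := ltgtP y 0; last by rewrite yE eqxx in y0.
- have := eU (- y); rewrite /ball_ /= sub0r opprK; apply=> //.
  by rewrite oppr_gt0.
- by apply: dU => //; rewrite /ball_ /= sub0r normrN.
Qed.

Lemma cvg_right_eq (R : realType) (T : topologicalType) (f f' : R -> T) (l : T) :
  (forall y, 0 < y -> f y = f' y) -> f @ 0^'+ --> l -> f' @ 0^'+ --> l.
Proof.
move=> ff; apply: cvg_trans; apply: near_eq_cvg.
by apply: filterS (nbhs_right_gt 0) => y y0; exact: ff.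
Qed.

Lemma cvg_right_id (R : realType) : (fun y : R => y%:C : R[i]^o) @ 0^'+ --> (0 : R[i]^o).
Proof. by apply: (@cvg_realC R R _ _ id 0); apply: cvg_at_right_filter; exact: cvg_id. Qed.

Section GammaField.
Variables (R : realType) (V : hilbertType R).

(** Convergence of the norms is enough when the distances are bounded by their
    differences; [gamma_dist] and [scaled_gamma_dist] provide such bounds. *)
Lemma cvg_of_cvg_sqn (u : R -> V) (L : R) :
  (forall x y, 0 < x -> 0 < y -> sqn (u x - u y) <= `|sqn (u x) - sqn (u y)|) ->
  (fun y => sqn (u y)) @ 0^'+ --> L -> exists l : V, u @ 0^'+ --> l.
Proof.
move=> uq qL.
apply: (@cvg_cauchy_sqn _ _ _ _ _ [set y | 0 < y] u (fun y => sqn (u y) - L)).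
- exact: nbhs_right_gt.
- move=> x y x0 y0; apply: le_trans (uq _ _ x0 y0) _.
  have -> : sqn (u x) - sqn (u y) = (sqn (u x) - L) - (sqn (u y) - L) by ring.
  by apply: le_trans (ler_normB _ _) _.
- rewrite -[X in _ --> X](subrr L).
  by apply: cvgB => //; exact: cvg_cst.
Qed.

(** [cvg_frame], with the limit identified by its inner products. *)
Lemma weak_cvg (T : Type) (F : set_system T) {FF : ProperFilter F}
    (G : hilbertType R) (M : set G) (t : seq G) (u : T -> G) (c : G -> R[i]) :
  is_subspace M -> {in t, forall e, M e} -> (forall x, M x -> x = fourier_sum t x) ->
  (\forall i \near F, M (u i)) ->
  (forall k, M k -> (fun i => hdot (u i) k : R[i]^o) @ F --> (c k : R[i]^o)) ->
  exists b, [/\ M b, u @ F --> b & forall k, M k -> hdot b k = c k].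
Proof.
move=> sM tM tP Mu uc; exists (\sum_(e <- t) c e *: e).
have ub : u @ F --> \sum_(e <- t) c e *: e.
  by apply: (@cvg_frame _ G T F _ M t u c tP Mu) => e et; apply: uc; exact: tM.
split=> // [|k Mk]; first exact: sum_subspace.
have h1 : (fun i => hdot (u i) k : R[i]^o) @ F --> (hdot (\sum_(e <- t) c e *: e) k : R[i]^o).
  by apply: cvg_hdot => //; exact: cvg_cst.
exact: (cvg_unique (@norm_hausdorff _ R[i]^o) h1 (uc k Mk)).
Qed.

(** [T y] stands for tau0 (t + iy) and [g y] for the gamma field at t + iy;
    [Tg] is Green's identity between two values of the latter. *)
Section Analytic.
Variables (G : hilbertType R) (M : set G) (t : seq G) (T : R -> G -> G) (g : R -> G -> V).
Hypotheses (sM : is_subspace M) (tM : {in t, forall e, M e})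
  (tP : forall x, M x -> x = fourier_sum t x).
Hypothesis TM : forall y h, y != 0 -> M h -> M (T y h).
Hypothesis Tadj : forall y h k, y != 0 -> M h -> M k ->
  hdot (T y h) k = hdot h (T (- y) k).
Hypothesis Tg : forall y x h k, 0 < y -> 0 < x -> M h -> M k ->
  hdot (T y h) k - hdot h (T x k) = 'i * (y + x)%:C * hdot (g y h) (g x k).

Lemma Im_form_gamma y h : 0 < y -> M h -> complex.Im (hdot (T y h) h) = y * sqn (g y h).
Proof.
move=> y0 Mh; have := Tg y0 y0 Mh Mh.
rewrite (hdotC (T y h)) hdotxx; case: (hdot (T y h) h) => a b.
rewrite conjcE; simpc => -[/= E]; lra.
Qed.

Lemma Re_gamma y x h : 0 < y -> 0 < x -> M h ->
  (y + x) * complex.Re (hdot (g y h) (g x h)) = y * sqn (g y h) + x * sqn (g x h).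
Proof.
move=> y0 x0 Mh; have := Tg y0 x0 Mh Mh; rewrite -!Im_form_gamma// (hdotC (T x h)).
case: (hdot (T y h) h) (hdot (T x h) h) (hdot (g y h) (g x h)) => a b [c d] [k l].
rewrite conjcE; simpc => -[_ /= E]; lra.
Qed.

(** Expanding the square with [Tg].  The sign shows that |g(y) h|^2 decreases
    in y, and that its boundedness makes g(y) h Cauchy at 0+. *)
Lemma gamma_dist y x h : 0 < y -> 0 < x -> M h ->
  (y + x) * sqn (g y h - g x h) = (x - y) * (sqn (g y h) - sqn (g x h)).
Proof.
move=> y0 x0 Mh; rewrite sqnB; have := Re_gamma y0 x0 Mh.
move: (complex.Re _) => r E.
have -> : (y + x) * (sqn (g y h) + sqn (g x h) - r *+ 2) =
  (y + x) * (sqn (g y h) + sqn (g x h)) - ((y + x) * r) *+ 2 by ring.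
by rewrite E; ring.
Qed.

Lemma sqn_scaled_gamma y h : sqn (y%:C *: g y h) = y ^+ 2 * sqn (g y h).
Proof. by rewrite sqnZ conjcR -rmorphM /= -expr2. Qed.

(** The sign is opposite to that of [gamma_dist]: |y g(y) h|^2 increases in y, so
    that it always converges at 0+. *)
Lemma scaled_gamma_dist y x h : 0 < y -> 0 < x -> M h ->
  (y + x) * sqn (y%:C *: g y h - x%:C *: g x h) =
  (y - x) * (sqn (y%:C *: g y h) - sqn (x%:C *: g x h)).
Proof.
move=> y0 x0 Mh; rewrite sqnB !sqn_scaled_gamma hdotZl hdotZr conjcR mulrA -rmorphM.
have := Re_gamma y0 x0 Mh.
case: (hdot (g y h) (g x h)) => r r'; simpc => /= E.
have -> : (y + x) * (y ^+ 2 * sqn (g y h) + x ^+ 2 * sqn (g x h) + (- (y * x * r) - y * x * r)) =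
  (y + x) * (y ^+ 2 * sqn (g y h) + x ^+ 2 * sqn (g x h)) - y * x * ((y + x) * r) *+ 2 by ring.
by rewrite E; ring.
Qed.

(** Since |y - x| <= y + x for positive x and y, the two distance formulas bound
    a distance by a difference of squared norms. *)
Lemma dist_le_diff (y x s d e : R) : 0 < y -> 0 < x ->
  (y + x) * s = e * d -> `|e| = `|y - x| -> s <= `|d|.
Proof.
move=> y0 x0 E eE; rewrite -(ler_pM2l (addr_gt0 y0 x0)) E.
apply: le_trans (ler_norm _) _; rewrite normrM eE ler_wpM2r//.
by rewrite ler_norml; lra.
Qed.

(** In spectral terms this is, up to the factor i, the component of the gamma
    field at the point t: y / (s - t - iy) tends to 0 for s <> t. *)
Definition residue h : V := lim ((fun y => y%:C *: g y h) @ 0^'+).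

Lemma residueP h : M h -> (fun y => y%:C *: g y h) @ 0^'+ --> residue h.
Proof.
move=> Mh.
have mono : {in Interval (BRight 0) (BInfty R false) &,
    {homo (fun y => sqn (y%:C *: g y h)) : n m / n <= m}}.
  move=> x y; rewrite !in_itv /= !andbT => x0 y0 xy.
  have [->//|xny] := eqVneq x y.
  rewrite -subr_ge0 -(@pmulr_rge0 _ (y - x)) ?subr_gt0 ?lt_def 1?eq_sym ?xny//.
  by rewrite -(scaled_gamma_dist y0 x0 Mh) mulr_ge0 ?sqn_ge0 ?addr_ge0 ?ltW.
have [l ll] : exists l : V, (fun y => y%:C *: g y h) @ 0^'+ --> l.
  apply: (cvg_of_cvg_sqn (u := fun y => y%:C *: g y h)); last first.
    apply: (nondecreasing_at_right_cvgr _ mono) => //.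
    by exists 0 => _ [y _ <-]; exact: sqn_ge0.
  by move=> x y x0 y0; apply: (dist_le_diff x0 y0 (scaled_gamma_dist x0 y0 Mh)).
by rewrite /residue (cvg_lim _ ll)//; exact: norm_hausdorff.
Qed.

(** Multiplied by y, the identity [Tg] shows that the left side, times i, is the
    limit of y (T(y) h, k) for each x; so it does not depend on x, and x -> 0+
    gives its value. *)
Lemma residue_gamma x h k : 0 < x -> M h -> M k ->
  x%:C * hdot (residue h) (g x k) = hdot (residue h) (residue k).
Proof.
move=> x0 Mh Mk.
have yT z : 0 < z -> (fun y => y%:C * hdot (T y h) k : R[i]^o) @ 0^'+ -->
    ('i * (z%:C * hdot (residue h) (g z k)) : R[i]^o).
  move=> z0.
  have c1 : (fun y => y%:C * hdot h (T z k) +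
      'i * (y + z)%:C * hdot (y%:C *: g y h) (g z k) : R[i]^o) @ 0^'+
     --> (0 * hdot h (T z k) + 'i * (0 + z)%:C * hdot (residue h) (g z k) : R[i]^o).
    apply: (@cvgD R[i] R[i]^o).
      by apply: (@cvgM R[i]); [exact: cvg_right_id|exact: cvg_cst].
    apply: (@cvgM R[i]); last by apply: cvg_hdot; [exact: residueP|exact: cvg_cst].
    apply: (@cvgM R[i]); first exact: cvg_cst.
    apply: cvg_realC; apply: cvgD; last exact: cvg_cst.
    by apply: cvg_at_right_filter; exact: cvg_id.
  rewrite mul0r !add0r -mulrA in c1; apply: cvg_right_eq c1 => y y0.
  rewrite hdotZl; have /eqP := Tg y0 z0 Mh Mk; rewrite subr_eq => /eqP ->.
  by ring.
have xE z : 0 < z -> z%:C * hdot (residue h) (g z k) = x%:C * hdot (residue h) (g x k).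
  move=> z0; apply: (@mulfI _ 'i); first by rewrite eq_complex /= oner_eq0 andbF.
  exact: (cvg_unique (@norm_hausdorff _ R[i]^o) (yT z z0) (yT x x0)).
have c2 : (fun z => hdot (residue h) (z%:C *: g z k) : R[i]^o) @ 0^'+ -->
    (hdot (residue h) (residue k) : R[i]^o).
  by apply: cvg_hdot; [exact: cvg_cst|exact: residueP].
have c3 : (fun z : R => x%:C * hdot (residue h) (g x k) : R[i]^o) @ 0^'+ -->
    (hdot (residue h) (residue k) : R[i]^o).
  by apply: cvg_right_eq c2 => z z0; rewrite hdotZr conjcR xE.
exact: (cvg_unique (@norm_hausdorff _ R[i]^o) (cvg_cst _) c3).
Qed.

Lemma gamma_residue x h k : 0 < x -> M h -> M k ->
  x%:C * hdot (g x k) (residue h) = hdot (residue k) (residue h).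
Proof.
move=> x0 Mh Mk; rewrite (hdotC (residue h)) (hdotC (residue h) (residue k)).
by rewrite -(residue_gamma x0 Mh Mk) rmorphM /= conjcR.
Qed.

Lemma cvg_residue_form h k : M h -> M k ->
  (fun y => - 'i * y%:C * hdot (T y h) k : R[i]^o) @ 0^'+ -->
  (hdot (residue h) (residue k) : R[i]^o).
Proof.
move=> Mh Mk.
have c1 : (fun y => - 'i * y%:C * hdot h (T 1 k) +
    (y + 1)%:C * hdot (y%:C *: g y h) (g 1 k) : R[i]^o) @ 0^'+
   --> (- 'i * 0 * hdot h (T 1 k) + (0 + 1)%:C * hdot (residue h) (g 1 k) : R[i]^o).
  apply: (@cvgD R[i] R[i]^o).
    apply: (@cvgM R[i]); last exact: cvg_cst.
    by apply: (@cvgM R[i]); [exact: cvg_cst|exact: cvg_right_id].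
  apply: (@cvgM R[i]); last by apply: cvg_hdot; [exact: residueP|exact: cvg_cst].
  apply: cvg_realC; apply: cvgD; last exact: cvg_cst.
  by apply: cvg_at_right_filter; exact: cvg_id.
rewrite mulr0 mul0r !add0r (residue_gamma ltr01)// in c1; apply: cvg_right_eq c1 => y y0.
rewrite hdotZl; have /eqP := Tg y0 ltr01 Mh Mk; rewrite subr_eq => /eqP ->.
have i2 := mul_ii R.
by ring: i2.
Qed.

Lemma near_op_in h : M h -> \forall y \near 0^', M (T y h).
Proof. by move=> Mh; near=> y; apply: TM => //; near: y; exact: nbhs_dnbhs_neq.
Unshelve. all: by end_near. Qed.

(** From above, [cvg_residue_form]; from below, the adjoint of it, the Gram form
    of the residues being Hermitian. *)
Lemma residue_op h : M h -> exists b, [/\ M b,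
  (fun y => (- 'i * y%:C) *: T y h) @ 0^' --> b &
  forall k, M k -> hdot b k = hdot (residue h) (residue k)].
Proof.
move=> Mh; apply: (weak_cvg sM tM tP) => [|k Mk].
  apply: filterS (near_op_in Mh) => y My.
  exact: subspaceZ.
under eq_fun do rewrite hdotZl.
apply: cvg_dnbhs0_sym; first exact: cvg_residue_form.
have c1 := cvg_conj (FF := at_right_proper_filter 0) (cvg_residue_form Mk Mh).
rewrite -hdotC in c1; apply: cvg_right_eq c1 => y y0.
rewrite rmorphM /= rmorphM /= -hdotC conjcR rmorphN /= conj_i.
rewrite Tadj ?oppr_eq0 ?gt_eqF// !opprK rmorphN /=; ring.
Qed.

(** By [residue_op] the form (residue h, residue k) is that of an operator, so
    the defect of linearity is orthogonal to every residue, hence to itself. *)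
Lemma residue_linear a h k : M h -> M k -> residue (a *: h + k) = a *: residue h + residue k.
Proof.
move=> Mh Mk; have Mhk : M (a *: h + k) by apply: sM.2.
apply/subr0_eq.
have dd m : M m -> hdot (residue m) (residue (a *: h + k) - (a *: residue h + residue k)) = 0.
  move=> Mm; have [b [_ _ bP]] := residue_op Mm.
  rewrite hdotDr hdotNr hdotDr hdotZr -!bP// hdotDr hdotZr; ring.
apply: sqn_eq0; rewrite /sqn {1}hdotDl hdotNl hdotDl hdotZl !dd//.
by rewrite mulr0 addr0 subrr.
Qed.

Section Regular.
Variables (h : G) (L : R).
Hypotheses (Mh : M h) (hL : (fun y => sqn (g y h)) @ 0^'+ --> L).

(** The product y (g(y) h, residue k) is constant in y, by [gamma_residue], and
    tends to 0 when g(y) h converges; so g(y) h is orthogonal to the residues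
    already before the limit. *)
Lemma boundary_gamma : exists2 w, (fun y => g y h) @ 0^'+ --> w &
  forall k, M k -> hdot w (residue k) = 0.
Proof.
have [w wP] : exists w : V, (fun y => g y h) @ 0^'+ --> w.
  apply: cvg_of_cvg_sqn hL => x y x0 y0.
  by apply: (dist_le_diff x0 y0 (gamma_dist x0 y0 Mh)); rewrite distrC.
exists w => // k Mk.
have c0 : (fun y => y%:C * hdot (g y h) (residue k) : R[i]^o) @ 0^'+ -->
    (0 * hdot w (residue k) : R[i]^o).
  apply: (@cvgM R[i]); first exact: cvg_right_id.
  by apply: cvg_hdot => //; exact: cvg_cst.
(* The left side of [c0] is the constant (residue h, residue k). *)
have hk0 : hdot (residue h) (residue k) = 0.
  rewrite mul0r in c0; apply: (cvg_unique (@norm_hausdorff _ R[i]^o) _ c0).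
  by apply: cvg_right_eq (cvg_cst _) => y y0; rewrite gamma_residue.
have c1 : (fun y => hdot (g y h) (residue k) : R[i]^o) @ 0^'+ --> (hdot w (residue k) : R[i]^o).
  by apply: cvg_hdot => //; exact: cvg_cst.
apply: (cvg_unique (@norm_hausdorff _ R[i]^o) c1).
apply: cvg_right_eq (cvg_cst _) => y y0; apply/esym/eqP.
have /eqP := gamma_residue y0 Mk Mh; rewrite hk0 mulf_eq0 => /orP[/eqP[/eqP]|//].
by rewrite gt_eqF.
Qed.

(** By [Tg] the difference (T(y) h, k) - (T(-y) h, k) equals
    2 i (g(y) h, y g(y) k), which tends to 2 i (w, residue k) = 0; so the limits
    from both sides agree. *)
Lemma boundary_op : exists2 d, M d & (fun y => T y h) @ 0^' --> d.
Proof.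
have [w wP wR] := boundary_gamma.
suff [d [Md dP _]] : exists b, [/\ M b, (fun y => T y h) @ 0^' --> b &
  forall k, M k -> hdot b k = hdot h (T 1 k) + 'i * hdot w (g 1 k)] by exists d.
apply: (weak_cvg sM tM tP) => [|k Mk]; first exact: near_op_in.
have c1 : (fun y => hdot (T y h) k : R[i]^o) @ 0^'+ --> (hdot h (T 1 k) + 'i * hdot w (g 1 k) : R[i]^o).
  have c2 : (fun y => hdot h (T 1 k) + 'i * (y + 1)%:C * hdot (g y h) (g 1 k) : R[i]^o) @ 0^'+ -->
    (hdot h (T 1 k) + 'i * (0 + 1)%:C * hdot w (g 1 k) : R[i]^o).
    apply: (@cvgD R[i] R[i]^o); first exact: cvg_cst.
    apply: (@cvgM R[i]); last by apply: cvg_hdot => //; exact: cvg_cst.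
    apply: (@cvgM R[i]); first exact: cvg_cst.
    apply: cvg_realC; apply: cvgD; last exact: cvg_cst.
    by apply: cvg_at_right_filter; exact: cvg_id.
  rewrite add0r mulr1 in c2; apply: cvg_right_eq c2 => y y0.
  by rewrite -Tg// addrC subrK.
apply: cvg_dnbhs0_sym => //.
have c3 : (fun y => hdot (T y h) k - 2 * 'i * hdot (g y h) (y%:C *: g y k) : R[i]^o) @ 0^'+ -->
    (hdot h (T 1 k) + 'i * hdot w (g 1 k) - 2 * 'i * hdot w (residue k) : R[i]^o).
  apply: (@cvgB R[i] R[i]^o); first exact: c1.
  apply: (@cvgM R[i]); first exact: cvg_cst.
  by apply: cvg_hdot => //; exact: residueP.
have cE : hdot h (T 1 k) + 'i * hdot w (g 1 k) - 2 * 'i * hdot w (residue k) =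
    hdot h (T 1 k) + 'i * hdot w (g 1 k) by rewrite wR// mulr0 subr0.
rewrite cE in c3; apply: cvg_right_eq c3 => y y0.
rewrite [RHS]Tadj ?oppr_eq0 ?gt_eqF// opprK hdotZr conjcR.
rewrite -[RHS](subKr (hdot (T y h) k)) Tg// rmorphD /=; ring.
Qed.

End Regular.

Definition Im_quotient h (y : R) : R := y^-1 * complex.Im (hdot (T y h) h).

Lemma Im_quotientE y h : 0 < y -> M h ->
  Im_quotient h y = sqn (g y h) /\ Im_quotient h (- y) = sqn (g y h).
Proof.
move=> y0 Mh; have yN : y != 0 by rewrite gt_eqF.
have := Im_form_gamma y0 Mh; split; first by rewrite /Im_quotient H mulKf.
rewrite /Im_quotient Tadj ?oppr_eq0// opprK hdotC.
move: H; case: (hdot (T y h) h) => a b /= ->.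
by rewrite invrN mulrNN mulKf.
Qed.

(** The quotient equals |g(y) h|^2 both at y and at - y. *)
Lemma cvg_Im_quotientP h : M h ->
  cvg (Im_quotient h @ 0^') <-> exists L : R, (fun y => sqn (g y h)) @ 0^'+ --> L.
Proof.
move=> Mh; split=> [/cvg_ex[L /cvg_dnbhs_at_right qL]|[L gL]].
  by exists L; apply: cvg_right_eq qL => y y0; exact: (Im_quotientE y0 Mh).1.
apply/cvg_ex; exists L; apply: cvg_dnbhs0_sym.
  by apply: cvg_right_eq gL => y y0; exact/esym/(Im_quotientE y0 Mh).1.
by apply: cvg_right_eq gL => y y0; exact/esym/(Im_quotientE y0 Mh).2.
Qed.

(** The squared norm increases as y decreases to 0, by [gamma_dist]. *)
Lemma cvg_sqn_gamma h c : M h -> (forall y, 0 < y -> sqn (g y h) <= c) ->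
  exists L : R, (fun y => sqn (g y h)) @ 0^'+ --> L.
Proof.
move=> Mh bd.
have mono : {in Interval (BRight 0) (BInfty R false) &,
    {homo (fun y => sqn (g y h)) : m n /~ n <= m}}.
  move=> x y; rewrite !in_itv /= !andbT => x0 y0 xy.
  have [->//|xny] := eqVneq x y.
  rewrite -subr_ge0 -(@pmulr_rge0 _ (y - x)) ?subr_gt0 ?lt_def 1?eq_sym ?xny//.
  by rewrite -(gamma_dist x0 y0 Mh) mulr_ge0 ?sqn_ge0 ?addr_ge0 ?ltW.
have ub : has_ubound [set sqn (g y h) | y in [set` Interval (BRight 0) (BInfty R false)]].
  by exists c => _ [y /= + <-]; rewrite in_itv /= andbT; exact: bd.
have := nonincreasing_at_right_cvgr (isT : (BRight 0 < BInfty R false)%O) mono ub.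
by move=> gL; eexists; exact: gL.
Qed.

End Analytic.
End GammaField.

(** * The values at a real point *)

Section RealPoint.
Variables (R : realType) (V G : hilbertType R) (K : set G) (tau0 : R[i] -> G -> G) (t : R).
Variables (C : V * V -> G * G -> Prop) (s : seq G) (g : R -> G -> V).
Let M := orth K.
Let T y := tau0 (t +i* y).
Hypotheses (sM : {in s, forall e, M e}) (sP : forall x, M x -> x = fourier_sum s x).
Hypotheses (KP : forall x, orth M x -> K x).
Hypothesis TM : forall y h, y != 0 -> M h -> M (T y h).
Hypothesis Tadj : forall y h k, y != 0 -> M h -> M k ->
  hdot (T y h) k = hdot h (T (- y) k).
Hypothesis Cgreen : forall p q p' q', C p q -> C p' q' ->
  hdot p.2 p'.1 - hdot p.1 p'.2 = hdot q.2 q'.1 - hdot q.1 q'.2.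
Hypothesis Cg : forall y h, 0 < y -> M h ->
  C (g y h, (t +i* y) *: g y h) (h, T y h).
Hypothesis CK : forall k, K k -> C (0, 0) (0, k).

Let lM : is_subspace M := orth_subspace K.

Lemma gamma_green y x h k : 0 < y -> 0 < x -> M h -> M k ->
  hdot (T y h) k - hdot h (T x k) = 'i * (y + x)%:C * hdot (g y h) (g x k).
Proof.
move=> y0 x0 Mh Mk; have /= <- := Cgreen (Cg y0 Mh) (Cg x0 Mk).
rewrite hdotZl hdotZr conjcE -mulrBl; congr (_ * _).
by apply/eqP; rewrite eq_complex /=; apply/andP; split; apply/eqP; ring.
Qed.

(** The pairs (0, k) with k in [K] are coupled with 0. *)
Lemma coupling_dom p q : C p q -> M q.1.
Proof.
move=> Cpq k /CK Ck; have /= := Cgreen Cpq Ck.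
by rewrite !hdot0r subrr sub0r => /eqP; rewrite eq_sym oppr_eq0 => /eqP.
Qed.

Lemma coupling_real_green r h h' y k : C (r, t%:C *: r) (h, h') -> 0 < y -> M k ->
  'i * y%:C * hdot r (g y k) = hdot h' k - hdot h (T y k).
Proof.
move=> Cr y0 Mk; have /= <- := Cgreen Cr (Cg y0 Mk).
rewrite hdotZl hdotZr conjcE -mulrBl; congr (_ * _).
by apply/eqP; rewrite eq_complex /=; apply/andP; split; apply/eqP; ring.
Qed.

(** For real t the number (h', h) is real, so the imaginary part of
    [coupling_real_green] with k = h reads |g(y) h|^2 = Re (r, g(y) h), and
    |r - g(y) h|^2 >= 0 gives the bound. *)
Lemma gamma_bounded r h h' y : C (r, t%:C *: r) (h, h') -> 0 < y ->
  sqn (g y h) <= sqn r.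
Proof.
move=> Cr y0; have Mh : M h := coupling_dom Cr.
have /= := Cgreen Cr Cr; rewrite hdotZl hdotZr conjcR subrr (hdotC h') => sym.
have := coupling_real_green Cr y0 Mh; rewrite (hdotC (T y h) h) => E.
have := Im_form_gamma gamma_green y0 Mh; have := sqn_ge0 (r - g y h); rewrite sqnB.
move: sym E; case: (hdot r (g y h)) (hdot h' h) (hdot (T y h) h) => a b [c d] [k l].
rewrite !conjcE; simpc => -[/= dd]; simpc => -[/= _ yE] sq lE.
have : y * (sqn (g y h) - a) = 0 by rewrite mulrBr -lE yE; lra.
move/eqP; rewrite mulf_eq0 gt_eqF//= subr_eq0 => /eqP aE.
move: sq; rewrite -aE; lra.
Qed.

(** The residues form a finite-dimensional subspace, onto which [x] is
    projected. *)
Lemma residue_proj x : exists2 h0, M h0 &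
  forall k, M k -> hdot (x - residue g h0) (residue g k) = 0.
Proof.
have rlin := residue_linear lM sM sP TM Tadj gamma_green.
have res0 : residue g 0 = 0.
  have := rlin (-1) 0 0 lM.1 lM.1.
  by rewrite scaleN1r oppr0 addr0 scaleN1r addNr.
pose W := [set residue g k | k in M].
have lW : is_subspace W.
  split; first by exists 0 => //; exact: lM.1.
  move=> a _ _ [h Mh <-] [k Mk <-]; exists (a *: h + k); first exact: lM.2.
  exact: rlin.
have [|w wW wP] := @gram_schmidt _ _ W (map (residue g) s) lW.
  by move=> _ /mapP[e es ->]; exists e => //; exact: sM.
have [h0 Mh0 h0E] : W (fourier_sum w x) by exact: sum_subspace.
exists h0 => //; rewrite h0E => k Mk.
pose N := [set k | M k /\ hdot (x - fourier_sum w x) (residue g k) = 0].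
have lN : is_subspace N.
  split; first by split; [exact: lM.1|rewrite res0 hdot0r].
  move=> a u v [Mu u0] [Mv v0]; split; first exact: lM.2.
  by rewrite rlin// hdotDr hdotZr u0 v0 mulr0 addr0.
suff [] : N k by [].
rewrite (sP Mk); apply: sum_subspace => // e es; split; first exact: sM.
by apply: wP; exact: map_f.
Qed.

Lemma cvg_nev_B h : M h -> [/\ M (nev_B tau0 t h),
  (fun y => (- 'i * y%:C) *: T y h) @ 0^' --> nev_B tau0 t h &
  forall k, M k -> hdot (nev_B tau0 t h) k = hdot (residue g h) (residue g k)].
Proof.
move=> Mh; have [b [Mb bP bE]] := residue_op lM sM sP TM Tadj gamma_green Mh.
suff -> : nev_B tau0 t h = b by [].
by apply: (cvg_lim (@norm_hausdorff _ G)); exact: bP.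
Qed.

Lemma cvg_nev_D h : nev_domD M tau0 t h ->
  [/\ M h, M (nev_D tau0 t h) & (fun y => T y h) @ 0^' --> nev_D tau0 t h].
Proof.
case=> Mh /(cvg_Im_quotientP Tadj gamma_green Mh)[L hL].
have [d Md dP] := boundary_op lM sM sP TM Tadj gamma_green Mh hL.
suff -> : nev_D tau0 t h = d by [].
by apply: (cvg_lim (@norm_hausdorff _ G)); exact: dP.
Qed.

(** The boundary value h is in the domain of D(t) by [gamma_bounded].  The limit
    of [coupling_real_green] gives (h' - D h, k) = i (r, residue k); if
    residue h0 is the projection of - i r, this is - (B h0, k), so that the
    remainder is orthogonal to M. *)
Lemma coupling_in_eta r h h' : C (r, t%:C *: r) (h, h') -> nev_eta K tau0 t (h, - h').
Proof.
move=> Cr; have Mh : M h := coupling_dom Cr.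
have domh : nev_domD M tau0 t h.
  split=> //; apply/(cvg_Im_quotientP Tadj gamma_green Mh).
  by apply: (cvg_sqn_gamma gamma_green Mh) => y; exact: gamma_bounded Cr.
have [_ Md dP] := cvg_nev_D domh; set d := nev_D tau0 t h in Md dP *.
have hd k : M k -> hdot (h' - d) k = 'i * hdot r (residue g k).
  move=> Mk.
  have c1 : (fun y => 'i * hdot r (y%:C *: g y k) : R[i]^o) @ 0^'+ -->
      ('i * hdot r (residue g k) : R[i]^o).
    apply: (@cvgM R[i]); first exact: cvg_cst.
    by apply: cvg_hdot; [exact: cvg_cst|exact: (residueP gamma_green)].
  (* Green's identity produces (h, T y k) = (T (- y) h, k), so the limit from
     below the real axis is the one that enters. *)
  have dN : (fun y => T (- y) h) @ 0^'+ --> d.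
    by have /cvg_at_leftNP := cvg_dnbhs_at_left dP; rewrite oppr0.
  have c2 : (fun y => hdot (h' - T (- y) h) k : R[i]^o) @ 0^'+ --> (hdot (h' - d) k : R[i]^o).
    apply: cvg_hdot; last exact: cvg_cst.
    by apply: cvgB => //; exact: cvg_cst.
  apply: (cvg_unique (@norm_hausdorff _ R[i]^o) c2).
  apply: cvg_right_eq c1 => y y0.
  rewrite hdotZr conjcR mulrA (coupling_real_green Cr)// hdotDl hdotNl.
  by rewrite Tadj ?oppr_eq0 ?gt_eqF// opprK.
have [h0 Mh0 h0P] := residue_proj (- 'i *: r).
have [Mb _ bE] := cvg_nev_B Mh0; set b := nev_B tau0 t h0 in Mb bE *.
exists h, h0, (- h' + d - b); split=> //; last first.
  congr pair; have -> : - h' + d - b = - h' - (- d + b) by rewrite opprD opprK addrA.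
  by rewrite addrC subrK.
apply: KP => k Mk; rewrite hdotDl hdotNl bE//.
have -> : - h' + d = - (h' - d) by rewrite opprB addrC.
have := h0P _ Mk; rewrite hdotNl hd// hdotDl hdotZl hdotNl.
by rewrite mulNr.
Qed.

Lemma cvg_vertical : (fun y : R => t +i* y : R[i]^o) @ 0^'+ --> (t%:C : R[i]^o).
Proof.
have c : (fun y => t%:C + 'i * y%:C : R[i]^o) @ 0^'+ --> (t%:C + 'i * 0 : R[i]^o).
  apply: (@cvgD R[i] R[i]^o); first exact: cvg_cst.
  by apply: (@cvgM R[i]); [exact: cvg_cst|exact: cvg_right_id].
rewrite mulr0 addr0 in c; apply: cvg_right_eq c => y _.
by simpc.
Qed.

(** Used for coupled pairs ((u y, (t + iy) u y), (z y, z' y)) converging as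
    y -> 0+: their limit satisfies the hypothesis of [coupling_maximal]. *)
Lemma green_limit (p : V * V) (q : G * G) (u : R -> V) (z z' : R -> G) (w : V) (k k' : G) :
  (forall y, 0 < y -> hdot p.2 (u y) - hdot p.1 ((t +i* y) *: u y) =
     hdot q.2 (z y) - hdot q.1 (z' y)) ->
  u @ 0^'+ --> w -> z @ 0^'+ --> k -> z' @ 0^'+ --> k' ->
  hdot p.2 w - hdot p.1 (t%:C *: w) = hdot q.2 k - hdot q.1 k'.
Proof.
move=> E uw zk zk'.
have c2 : (fun y => hdot q.2 (z y) - hdot q.1 (z' y) : R[i]^o) @ 0^'+ -->
    (hdot q.2 k - hdot q.1 k' : R[i]^o).
  by apply: (@cvgB R[i] R[i]^o); apply: cvg_hdot => //; exact: cvg_cst.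
have c1 : (fun y => hdot p.2 (u y) - hdot p.1 ((t +i* y) *: u y) : R[i]^o) @ 0^'+ -->
    (hdot p.2 w - hdot p.1 (t%:C *: w) : R[i]^o).
  apply: (@cvgB R[i] R[i]^o); apply: cvg_hdot => //; try exact: cvg_cst.
  by apply: (@cvgZ R[i] V); [exact: cvg_vertical|exact: uw].
apply: (cvg_unique (@norm_hausdorff _ R[i]^o) c1).
by apply: cvg_right_eq c2 => y y0; rewrite E.
Qed.

(** The vector r is w + i v, where w is the limit of g(y) h and v the residue of
    h0.  The identities for (g(y) h, T(y) h) and for y times those of h0 pass to
    the limit; as y T(y) h0 tends to i B h0, they hold for w with the pair
    (h, D h) and for i v with the pair (0, - B h0). *)
Lemma eta_green (N : set V) h h' : is_subspace N -> closed N ->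
  (forall y k, 0 < y -> M k -> N (g y k)) ->
  nev_eta K tau0 t (h, h') ->
  exists2 r, N r & forall p q, C p q ->
    hdot p.2 r - hdot p.1 (t%:C *: r) = hdot q.2 h + hdot q.1 h'.
Proof.
move: h h' => h1 h1' lN cN Ng [h [h0 [k [domh Mh0 Kk [-> ->]]]]] {h1 h1'}.
have [Mh Md dP] := cvg_nev_D domh; set d := nev_D tau0 t h in Md dP *.
have [Mb bP bE] := cvg_nev_B Mh0; set b := nev_B tau0 t h0 in Mb bP bE *.
have [L hL] := (cvg_Im_quotientP Tadj gamma_green Mh).1 domh.2.
have [w wP _] := boundary_gamma gamma_green Mh hL.
have vP := residueP gamma_green Mh0; set v := residue g h0 in vP *.
have Nw : N w.
  apply: (@closed_cvg R V 0^'+ _ (fun y => g y h) N cN _ _ wP).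
  by apply: filterS (nbhs_right_gt 0) => y y0; exact: Ng.
have Nv : N v.
  apply: (@closed_cvg R V 0^'+ _ (fun y => y%:C *: g y h0) N cN _ _ vP).
  apply: filterS (nbhs_right_gt 0) => y y0.
  by apply: subspaceZ => //; exact: Ng.
exists (w + 'i *: v); first by rewrite addrC; exact: lN.2.
move=> p q Cpq.
have Ew : hdot p.2 w - hdot p.1 (t%:C *: w) = hdot q.2 h - hdot q.1 d.
  apply: (@green_limit _ _ (fun y => g y h) (fun=> h) (fun y => T y h)) => //.
  - by move=> y y0; exact: (Cgreen Cpq (Cg y0 Mh)).
  - exact: cvg_cst.
  - exact: cvg_dnbhs_at_right.
have Ev : hdot p.2 v - hdot p.1 (t%:C *: v) = hdot q.2 0 - hdot q.1 ('i *: b).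
  apply: (@green_limit _ _ (fun y => y%:C *: g y h0) (fun y => y%:C *: h0)
     (fun y => 'i *: ((- 'i * y%:C) *: T y h0))) => //.
  - move=> y y0; have /= E := Cgreen Cpq (Cg y0 Mh0).
    have -> : 'i *: ((- 'i * y%:C) *: T y h0) = y%:C *: T y h0.
      by rewrite scalerA mulrA mulrN mul_ii opprK mul1r.
    rewrite scalerA [_ * y%:C]mulrC -scalerA.
    by rewrite ![hdot _ (y%:C *: _)]hdotZr -!mulrBr E.
  - rewrite -[X in _ --> X](scale0r h0).
    by apply: (@cvgZ R[i] G); [exact: cvg_right_id|exact: cvg_cst].
  - by apply: cvgZl_tmp; exact: cvg_dnbhs_at_right.
have Ek : hdot q.1 k = 0.
  have /= := Cgreen Cpq (CK Kk); rewrite !hdot0r subrr sub0r => /eqP.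
  by rewrite eq_sym oppr_eq0 => /eqP.
rewrite scalerDr !hdotDr hdotNr Ek addr0 addrA -Ew.
have -> : hdot q.1 b = - 'i * (hdot p.2 v - hdot p.1 (t%:C *: v)).
  have i2 := mul_ii R.
  by rewrite Ev hdot0r sub0r hdotZr conj_i; ring: i2.
by rewrite scalerA [_ * 'i]mulrC -scalerA !hdotZr conj_i; ring.
Qed.

End RealPoint.

Theorem theorem3p6 (R : realType) (H : hilbertType R) (A : set (H * H))
    (n : nat) (G : hilbertType R) (G0 G1 : H * H -> G)
    (tau : R[i] -> set (G * G)) (K : set G) (tau0 : R[i] -> G -> G)
    (Ht : hilbertType R) (iota : {linear H -> Ht}) (At : set (Ht * Ht)) :
  is_subspace A -> closed A -> rel_symmetric A ->
  deficiency_plus A n -> deficiency_minus A n ->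
  boundary_triplet A G0 G1 ->
  nevanlinna_family tau ->
  nevanlinna_parts tau K tau0 ->
  exit_ext_of iota A G0 G1 tau At ->
  forall t : R,
    shtraus iota At t%:C = triplet_ext A G0 G1 (nev_eta K tau0 t).
Proof.
move=> lA cA sA dA _ bt nt np [[iso saAt AAt _] cE] t.
have [s0 tot] := triplet_total sA bt lA cA dA.
have [s sM sP] := frame_of_total (orth_subspace K) (orth_closed (M:=K)) tot.
have Im1 : complex.Im (t +i* 1 : R[i]) != 0 by rewrite /= oner_eq0.
have weyl l q : complex.Im l != 0 -> tau l q ->
    exists r, coupling iota A G0 G1 At (r, l *: r) q.
  by move=> l0; apply: coupling_weyl => //; exact: cE.
have green := coupling_green iso bt saAt.
have K0 : K 0 by rewrite -(np_mul np Im1); case: (nf_closed_rel nt Im1) => -[].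
have /choice[g0 g0P] : forall yh : R * G, exists r, 0 < yh.1 -> orth K yh.2 ->
    coupling iota A G0 G1 At (r, (t +i* yh.1) *: r) (yh.2, tau0 (t +i* yh.1) yh.2).
  move=> [y h] /=; have [y0|] := ltP 0 y; last by exists 0.
  have [Mh|] := pselect (orth K h); last by exists 0.
  have Iy : complex.Im (t +i* y : R[i]) != 0 by rewrite /= gt_eqF.
  have [|r Cr] := @weyl _ (h, tau0 (t +i* y) h) Iy; last by exists r.
  by rewrite (np_decomp np Iy); exists h, 0; split=> //; rewrite addr0.
pose g y h := g0 (y, h).
have Cg y h : 0 < y -> orth K h ->
    coupling iota A G0 G1 At (g y h, (t +i* y) *: g y h) (h, tau0 (t +i* y) h).
  exact: (g0P (y, h)).
(* The pair (0, x) lies in the adjoint of tau(l), whose multivalued part is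
   again [K]. *)
have KP x : orth (orth K) x -> K x.
  move=> Kx; have Im1' : complex.Im (Num.conj (t +i* 1 : R[i])) != 0.
    by rewrite conjcE /= oppr_eq0 oner_eq0.
  rewrite -(np_mul np Im1') /rel_mul /= -(nf_adjoint nt Im1) (np_decomp np Im1).
  move=> p [h0 [k [Mh0 _ ->]]] /=.
  by rewrite hdot0r hdotC Kx// rmorph0.
have TM y h : y != 0 -> orth K h -> orth K (tau0 (t +i* y) h).
  move=> y0 Mh.
  have [TM _ _] := no_bounded (np_op np) (y0 : complex.Im (t +i* y : R[i]) != 0).
  exact: TM.
have Tadj y h k : y != 0 -> orth K h -> orth K k ->
    hdot (tau0 (t +i* y) h) k = hdot h (tau0 (t +i* - y) k).
  by move=> y0 Mh Mk; rewrite (no_adjoint (np_op np) (y0 : complex.Im (t +i* y : R[i]) != 0)).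
have CK k : K k -> coupling iota A G0 G1 At (0, 0) (0, k).
  move=> Kk; have [|r Cr] := @weyl _ (0, k) Im1.
    by rewrite -[tau _ _]/(rel_mul (tau _) k) (np_mul np Im1).
  have /= := green _ _ _ _ Cr Cr; rewrite hdot0l hdot0r subrr hdotZl hdotZr conjcE -mulrBl hdotxx.
  simpc => -[/= E].
  (* Green's identity of the pair with itself reads 2 Im l |r|^2 = 0. *)
  have r0 : r = 0 by apply: sqn_eq0; lra.
  by move: Cr; rewrite r0 scaler0.
apply/seteqP; split=> f.
  move=> [r Or Tf].
  have Otr : orth (range iota) (t%:C *: r).
    exact: subspaceZ (orth_subspace _) Or.
  have Af : rel_adj A f by exact: (exit_adj iso saAt AAt (p := (r, t%:C *: r))).
  split=> //; rewrite -[G1 f]opprK.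
  have Cr : coupling iota A G0 G1 At (r, t%:C *: r) (G0 f, - G1 f).
    by exists f; split=> //=; rewrite opprK.
  exact: (coupling_in_eta sM sP KP TM Tadj green Cg CK Cr).
move=> [Af eta].
have [r Or rP] := eta_green (C := coupling iota A G0 G1 At) (g := g) sM sP TM Tadj green Cg CK
  (orth_subspace (range iota)) (orth_closed (M := range iota))
  (fun y k y0 Mk => let: ex_intro _ (And5 _ (conj o _) _ _ _) := Cg y k y0 Mk in o) eta.
exists r => //.
apply: (coupling_maximal iso bt saAt AAt (p := (r, t%:C *: r)) Af) => //=.
exact: subspaceZ (orth_subspace _) Or.
Qed.
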